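(* Let $R$ be a commutative noetherian local ring and $M$ a finitely generated $R$-module of finite G-dimension. Fix an integer $i\geq 0$ and a G-approximation $0\to K\to G\to M\to 0$. (a) If $i\neq 1$, there is an inequality $\chi^{\mathcal{G}}_i(M)\geq 0$. (b) There is an equality $\chi^{\mathcal{G}}_1(M)=\beta_0^R(M)-\beta_0^R(G)+\chi(K)$. In particular, $\chi^{\mathcal{G}}_1(M)\geq\beta_0^R(M)-\beta_0^R(G)$. (c) If $M$ has rank $r$, then $\chi^{\mathcal{G}}(M)\geq r$.
   Context: Let $(R,\mathfrak{m},k)$ be a commutative noetherian local ring and set $(-)^*=\operatorname{Hom}_R(-,R)$. A finitely generated $R$-module $G$ is totally reflexive if the biduality map $G\to G^{**}$ is bijective and $\operatorname{Ext}^i_R(G,R)=0=\operatorname{Ext}^i_R(G^*,R)$ for all $i\neq 0$. A G-resolution of a finitely generated module $M$ is a complex $G$ of totally reflexive modules with $G_n=0$ for $n<0$, $H_n(G)=0$ for $n>0$ and $H_0(G)\cong M$; its augmented G-resolution $G^+$ is the exact sequence $\cdots\to G_1\to G_0\to M\to 0$. The G-dimension is $\operatorname{G-dim}_R(M)=\inf\{\sup\{n\geq 0\mid G_n\neq 0\}\mid G \text{ is a G-resolution of } M\}$. A G-resolution $G$ is proper if $\operatorname{Hom}_R(H,G^+)$ is exact for every totally reflexive $R$-module $H$. Every finitely generated $M$ of finite G-dimension has a bounded proper G-resolution, and proper G-resolutions are unique up to homotopy equivalence, so $\operatorname{Tor}^{\mathcal{G}}_n(M,N)=H_n(G\otimes_R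 N)$, with $G$ a proper G-resolution of $M$, is well defined. The relative Betti numbers are $\beta_n^{\mathcal{G}}(M)=\dim_k\operatorname{Tor}_n^{\mathcal{G}}(M,k)$, which vanish for $n<0$ and $n>\operatorname{G-dim}_R(M)$. For $i\geq 0$, the $i$th G-Euler characteristic is $\chi^{\mathcal{G}}_i(M)=\sum_{n\geq i}(-1)^{n-i}\beta_n^{\mathcal{G}}(M)$, and $\chi^{\mathcal{G}}(M)=\chi^{\mathcal{G}}_0(M)$. The usual Betti numbers are $\beta_n^R(M)=\dim_k\operatorname{Tor}_n^R(M,k)$; when $\operatorname{pdim}_R(K)<\infty$, the classical Euler characteristic is $\chi(K)=\sum_{n\geq 0}(-1)^n\beta_n^R(K)$. A G-approximation of $M$ is an exact sequence $0\to K\to G\to M\to 0$ of finitely generated modules with $G$ totally reflexive and $\operatorname{pdim}_R(K)<\infty$. A finitely generated module $M$ has rank $r$ if $U^{-1}M\cong (U^{-1}R)^r$, where $U$ is the set of nonzerodivisors of $R$. *)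

(* Defs.v *)
From HB Require Import structures.
From mathcomp Require Import all_boot all_order all_algebra generic_quotient.
From mathcomp Require Import boolp classical_sets functions cardinality fsbigop.
From mathcomp Require Import freeg ring.

Set Implicit Arguments.
Unset Strict Implicit.
Unset Printing Implicit Defensive.

Import Order.TTheory GRing.Theory Num.Theory.
Local Open Scope ring_scope.
Local Open Scope quotient_scope.

(* Ideals of R are submodules of the regular module R^o. *)
Section Modules.
Variable R : comNzRingType.
Implicit Types U V W : lmodType R.

Definition is_zero V := forall x : V, x = 0.

Definition iso U V := exists f : {linear U -> V}, bijective f.

Definition fin_gen V := exists (n : nat) (e : 'I_n -> V),
  forall x, exists a : 'I_n -> R, x = \sum_i a i *: e i.

Record submod V (S : submodClosed V) :=
  SubMod { smval : V; smvalP : smval \in (S : {pred V}) }.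

Section Submod.
Variables (V : lmodType R) (S : submodClosed V).
HB.instance Definition _ := [isSub for @smval V S].
HB.instance Definition _ := [Choice of submod S by <:].
HB.instance Definition _ := [SubChoice_isSubLmodule of submod S by <:].
End Submod.

Definition ker_pred U V (f : {linear U -> V}) : {pred U} := fun x => f x == 0.
Definition im_pred U V (f : {linear U -> V}) : {pred V} :=
  fun y => `[<exists x, f x = y>].
Definition preim_pred U V (f : {linear U -> V}) (S : submodClosed V) :
  {pred U} := fun x => f x \in (S : {pred V}).
Definition zero_pred V : {pred V} := fun x => x == 0.
Definition full_pred V : {pred V} := fun=> true.
Definition span_pred V (A : V -> Prop) : {pred V} :=
  fun x => `[<forall S : submodClosed V,
                (forall y, A y -> y \in (S : {pred V})) ->
                x \in (S : {pred V})>].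

Fact ker_closed U V (f : {linear U -> V}) :
  GRing.subsemimod_closed (ker_pred f).
Proof.
split; [split=> [|x y] | move=> a x]; rewrite !unfold_in ?linear0 //.
- by move=> /eqP fx /eqP fy; rewrite linearD fx fy addr0.
- by move=> /eqP fx; rewrite linearZ /= fx scaler0.
Qed.
HB.instance Definition _ U V (f : {linear U -> V}) :=
  GRing.isSubSemiModClosed.Build R U (ker_pred f) (ker_closed f).

Fact im_closed U V (f : {linear U -> V}) : GRing.subsemimod_closed (im_pred f).
Proof.
split; [split=> [|x y] | move=> a x]; rewrite !unfold_in.
- by apply/asboolP; exists 0; rewrite linear0.
- move=> /asboolP[u <-] /asboolP[v <-]; apply/asboolP; exists (u + v).
  by rewrite linearD.
- by move=> /asboolP[u <-]; apply/asboolP; exists (a *: u); rewrite linearZ.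
Qed.
HB.instance Definition _ U V (f : {linear U -> V}) :=
  GRing.isSubSemiModClosed.Build R V (im_pred f) (im_closed f).

Lemma mem_preim U V (f : {linear U -> V}) (S : submodClosed V) x :
  (x \in preim_pred f S) = (f x \in (S : {pred V})).
Proof. by []. Qed.

Fact preim_closed U V (f : {linear U -> V}) (S : submodClosed V) :
  GRing.subsemimod_closed (preim_pred f S).
Proof.
split; [split=> [|x y] | move=> a x]; rewrite !mem_preim.
- by rewrite linear0 rpred0.
- by move=> fx fy; rewrite linearD rpredD.
- by move=> fx; rewrite linearZ rpredZ.
Qed.
HB.instance Definition _ U V (f : {linear U -> V}) (S : submodClosed V) :=
  GRing.isSubSemiModClosed.Build R U (preim_pred f S) (preim_closed f S).

Fact zero_closed V : GRing.subsemimod_closed (@zero_pred V).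
Proof.
split; [split=> [|x y] | move=> a x]; rewrite !unfold_in //.
- by move=> /eqP-> /eqP->; rewrite addr0.
- by move=> /eqP->; rewrite scaler0.
Qed.
HB.instance Definition _ V :=
  GRing.isSubSemiModClosed.Build R V (@zero_pred V) (@zero_closed V).

Fact full_closed V : GRing.subsemimod_closed (@full_pred V).
Proof. by []. Qed.
HB.instance Definition _ V :=
  GRing.isSubSemiModClosed.Build R V (@full_pred V) (@full_closed V).

Fact span_closed V (A : V -> Prop) : GRing.subsemimod_closed (span_pred A).
Proof.
split; [split=> [|x y] | move=> a x]; rewrite !unfold_in.
- by apply/asboolP => S AS; rewrite rpred0.
- move=> /asboolP Sx /asboolP Sy; apply/asboolP => S AS.
  by rewrite rpredD ?Sx ?Sy.
- by move=> /asboolP Sx; apply/asboolP => S AS; rewrite rpredZ ?Sx.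
Qed.
HB.instance Definition _ V (A : V -> Prop) :=
  GRing.isSubSemiModClosed.Build R V (span_pred A) (span_closed A).

Definition ker_sub U V (f : {linear U -> V}) : submodClosed U := ker_pred f.
Definition im_sub U V (f : {linear U -> V}) : submodClosed V := im_pred f.
Definition preim_sub U V (f : {linear U -> V}) (S : submodClosed V) :
  submodClosed U := preim_pred f S.
Definition zero_sub V : submodClosed V := @zero_pred V.
Definition full_sub V : submodClosed V := @full_pred V.
Definition span_sub V (A : V -> Prop) : submodClosed V := span_pred A.

Lemma span_min V (A : V -> Prop) (S : submodClosed V) x :
  (forall y, A y -> y \in (S : {pred V})) ->
  x \in (span_sub A : {pred V}) -> x \in (S : {pred V}).
Proof. by move=> AS; rewrite unfold_in => /asboolP; apply. Qed.

Lemma mem_span V (A : V -> Prop) x : A x -> x \in (span_sub A : {pred V}).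
Proof. by move=> Ax; rewrite unfold_in; apply/asboolP => S; apply. Qed.

Fact submod_zmod_closed V (S : submodClosed V) :
  GRing.zmod_closed (S : {pred V}).
Proof.
split=> [|x y Sx Sy]; first exact: rpred0.
by rewrite rpredD // -scaleN1r rpredZ.
Qed.

Definition zmod_of V (S : submodClosed V) : zmodClosed V :=
  HB.pack (S : {pred V})
    (GRing.isZmodClosed.Build V (S : {pred V}) (submod_zmod_closed S)).

Definition quotmod V (S : submodClosed V) := Quotient.quot (zmod_of S).

Section Quotmod.
Variables (V : lmodType R) (S : submodClosed V).
HB.instance Definition _ := Quotient.on (quotmod S).
HB.instance Definition _ := Choice.on (quotmod S).
HB.instance Definition _ := GRing.Zmodule.on (quotmod S).

Definition quotpi (x : V) : quotmod S := \pi_(Quotient.quot (zmod_of S)) x.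

Lemma quotpiE x y : (quotpi x == quotpi y) = (x - y \in (S : {pred V})).
Proof. by rewrite /quotpi -Quotient.idealrBE. Qed.

Lemma quotpiK (a : quotmod S) : quotpi (repr a) = a.
Proof. exact: reprK. Qed.

Lemma quotpiD x y : quotpi (x + y) = quotpi x + quotpi y.
Proof. exact: Quotient.pi_add. Qed.

Definition quotscale (a : R) (q : quotmod S) : quotmod S :=
  quotpi (a *: repr q).

Lemma quotpi_scale a x : quotpi (a *: x) = quotscale a (quotpi x).
Proof.
apply/eqP; rewrite quotpiE -scalerBr rpredZ // -quotpiE.
by rewrite quotpiK.
Qed.

Fact quotscaleA a b q : quotscale a (quotscale b q) = quotscale (a * b) q.
Proof. by rewrite -(quotpiK q) -!quotpi_scale scalerA. Qed.
Fact quotscale1 : left_id 1 quotscale.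
Proof. by move=> q; rewrite -(quotpiK q) -quotpi_scale scale1r. Qed.
Fact quotscaleDr : right_distributive quotscale +%R.
Proof.
move=> a p q; rewrite -(quotpiK p) -(quotpiK q).
by rewrite -quotpiD -!quotpi_scale -quotpiD scalerDr.
Qed.
Fact quotscaleDl q : {morph quotscale^~ q : a b / a + b}.
Proof.
by move=> a b; rewrite -(quotpiK q) -!quotpi_scale -quotpiD scalerDl.
Qed.
HB.instance Definition _ := GRing.Zmodule_isLmodule.Build R (quotmod S)
  quotscaleA quotscale1 quotscaleDr quotscaleDl.

Fact quotpi_linear : linear quotpi.
Proof. by move=> a x y; rewrite quotpiD quotpi_scale. Qed.
HB.instance Definition _ :=
  GRing.isLinear.Build R V (quotmod S) *:%R quotpi quotpi_linear.
End Quotmod.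

Section QuotMap.
Variables (U V : lmodType R) (S : submodClosed U) (T : submodClosed V).
Variable f : {linear U -> V}.
Hypothesis fST : forall x, x \in (S : {pred U}) -> f x \in (T : {pred V}).

Definition quotmap (q : quotmod S) : quotmod T := quotpi T (f (repr q)).

Lemma quotmapE x : quotmap (quotpi S x) = quotpi T (f x).
Proof.
apply/eqP; rewrite quotpiE -linearB fST //.
by rewrite -quotpiE quotpiK.
Qed.

Fact quotmap_linear : linear quotmap.
Proof.
move=> a p q; rewrite -(quotpiK p) -(quotpiK q) -linearP /=.
by rewrite !quotmapE !linearP.
Qed.
End QuotMap.

Definition hom_pred U V : {pred U -> V} := fun f => `[<linear f>].

Fact hom_closed U V : GRing.subsemimod_closed (@hom_pred U V).
Proof.
split; [split=> [|f g] | move=> a f]; rewrite !unfold_in.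
- by apply/asboolP => b x y; rewrite scaler0 addr0.
- move=> /asboolP lf /asboolP lg; apply/asboolP => b x y.
  by rewrite !addrfctE lf lg scalerDr addrACA.
- move=> /asboolP lf; apply/asboolP => b x y.
  by rewrite !scalrfctE lf scalerDr !scalerA mulrC.
Qed.
HB.instance Definition _ U V :=
  GRing.isSubSemiModClosed.Build R (U -> V) (@hom_pred U V) (@hom_closed U V).

Definition Hom U V : lmodType R := submod (@hom_pred U V).

Definition hom_fun U V (f : Hom U V) : U -> V := smval f.

Fact hom_fun_linear U V (f : Hom U V) : linear (hom_fun f).
Proof. by case: f => f lf; apply/asboolP. Qed.
HB.instance Definition _ U V (f : Hom U V) :=
  GRing.isLinear.Build R U V *:%R (hom_fun f) (hom_fun_linear f).

Fact hom_of_subproof U V (f : {linear U -> V}) :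
  (f : U -> V) \in (@hom_pred U V : {pred U -> V}).
Proof. by rewrite unfold_in; apply/asboolP; apply: linearP. Qed.
Definition hom_of U V (f : {linear U -> V}) : Hom U V :=
  SubMod (hom_of_subproof f).

Lemma hom_eqP U V (f g : Hom U V) : hom_fun f =1 hom_fun g -> f = g.
Proof. by move=> fg; apply: val_inj; apply/funext. Qed.

Definition hom_post H U V (f : {linear U -> V}) (h : Hom H U) : Hom H V :=
  hom_of (f \o hom_fun h).
Fact hom_post_linear H U V (f : {linear U -> V}) : linear (@hom_post H U V f).
Proof. by move=> a g h; apply: hom_eqP => x; rewrite /hom_fun /= linearP. Qed.
HB.instance Definition _ H U V (f : {linear U -> V}) :=
  GRing.isLinear.Build R (Hom H U) (Hom H V) *:%R (hom_post f)
    (hom_post_linear f).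

Definition hom_pre U V N (f : {linear U -> V}) (h : Hom V N) : Hom U N :=
  hom_of (hom_fun h \o f).
Fact hom_pre_linear U V N (f : {linear U -> V}) : linear (@hom_pre U V N f).
Proof. by move=> a g h; apply: hom_eqP => x. Qed.
HB.instance Definition _ U V N (f : {linear U -> V}) :=
  GRing.isLinear.Build R (Hom V N) (Hom U N) *:%R (@hom_pre U V N f)
    (@hom_pre_linear U V N f).

Definition dual V : lmodType R := Hom V R^o.

Definition dual_eval V (x : V) (f : dual V) : R^o := hom_fun f x.
Fact dual_eval_linear V (x : V) : linear (dual_eval x).
Proof. by []. Qed.
HB.instance Definition _ V (x : V) :=
  GRing.isLinear.Build R (dual V) R^o *:%R (dual_eval x) (dual_eval_linear x).

Definition biduality V (x : V) : dual (dual V) := hom_of (dual_eval x).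

Section Tensor.
Variables V N : lmodType R.
Local Notation F := {freeg (V * N)%type / R}.

Inductive bilin_rel : F -> Prop :=
| bilin_addl (x y : V) (z : N) :
    bilin_rel (<< (x + y, z) >> - << (x, z) >> - << (y, z) >>)
| bilin_addr (x : V) (y z : N) :
    bilin_rel (<< (x, y + z) >> - << (x, y) >> - << (x, z) >>)
| bilin_scalel (a : R) (x : V) (y : N) :
    bilin_rel (<< (a *: x, y) >> - a *: << (x, y) >>)
| bilin_scaler (a : R) (x : V) (y : N) :
    bilin_rel (<< (x, a *: y) >> - a *: << (x, y) >>).

Definition tensor : lmodType R := quotmod (span_sub bilin_rel).
End Tensor.

Section TensorMap.
Variables (U V N : lmodType R) (f : {linear U -> V}).
Local Notation FU := {freeg (U * N)%type / R}.
Local Notation FV := {freeg (V * N)%type / R}.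

Definition free_map : FU -> FV :=
  fglift (fun p : U * N => << (f p.1, p.2) >> : FV).

Fact free_map_linear : linear free_map.
Proof.
pose L : FU -> FV := free_map.
have LB : {morph L : x y / x - y} := lift_is_additive _.
have L0 : L 0 = 0 by rewrite -(subrr 0) LB subrr.
have LN x : L (- x) = - L x by rewrite -sub0r LB L0 sub0r.
have LD : {morph L : x y / x + y}.
  by move=> x y; rewrite -{1}[y]opprK LB LN opprK.
move=> a x y; change (L (a *: x + y) = a *: L x + L y).
rewrite LD; suff -> : L (a *: x) = a *: L x by [].
rewrite -(freeg_sumE x).
elim: (dom x) => [|p s IH]; first by rewrite !big_nil scaler0 L0 scaler0.
rewrite !big_cons scalerDr !LD scalerDr IH; congr (_ + _).
have -> : a *: << coeff p x *g p >> = << a * coeff p x *g p >> :> FU.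
  by apply/eqP/freeg_eqP => q; rewrite coeffZ !coeffU mulrA.
by rewrite /L /free_map !liftU scalerA.
Qed.
HB.instance Definition _ :=
  GRing.isLinear.Build R FU FV *:%R free_map free_map_linear.

Lemma free_mapE p : free_map << p >> = << (f p.1, p.2) >>.
Proof. by rewrite /free_map liftU scale1r. Qed.

Fact tensor_map_subproof x : x \in (span_sub (@bilin_rel U N) : {pred FU}) ->
  free_map x \in (span_sub (@bilin_rel V N) : {pred FV}).
Proof.
apply: (@span_min _ _ (preim_sub free_map (span_sub (@bilin_rel V N)))) => y yR.
change (free_map y \in (span_sub (@bilin_rel V N) : {pred FV})).
have fB a b : free_map (a - b) = free_map a - free_map b by apply: linearB.
have fZ a b : free_map (a *: b) = a *: free_map b by apply: linearZ.
apply: mem_span; case: {y} yR => [u v n|u n p|a u n|a u n].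
- by rewrite !fB !free_mapE /= linearD; apply: bilin_addl.
- by rewrite !fB !free_mapE /=; apply: bilin_addr.
- by rewrite fB fZ !free_mapE /= linearZ; apply: bilin_scalel.
- by rewrite fB fZ !free_mapE /=; apply: bilin_scaler.
Qed.

Definition tensor_map : tensor U N -> tensor V N :=
  quotmap (span_sub (@bilin_rel V N)) free_map.
HB.instance Definition _ := GRing.isLinear.Build R (tensor U N) (tensor V N)
  *:%R tensor_map (@quotmap_linear _ _ _ _ free_map tensor_map_subproof).

Lemma tensor_mapE x : tensor_map (quotpi _ x) = quotpi _ (free_map x).
Proof. exact: (@quotmapE _ _ _ _ free_map tensor_map_subproof x). Qed.
End TensorMap.

(* Indices are naturals: a complex vanishes in negative degrees, so every
   element of degree 0 is a cycle *)
Record complex := Complex {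
  cobj :> nat -> lmodType R;
  cdiff : forall n, {linear cobj n.+1 -> cobj n};
  cdiffK : forall n x, cdiff n (cdiff n.+1 x) = 0 }.

Definition cycles (C : complex) n : submodClosed (C n) :=
  match n with
  | 0 => full_sub (C 0)
  | n.+1 => ker_sub (cdiff C n)
  end.
Definition boundaries (C : complex) n : submodClosed (C n) :=
  im_sub (cdiff C n).

Definition subquot V (Z B : submodClosed V) : lmodType R :=
  quotmod (preim_sub (\val : submod Z -> V) B).

Definition homology (C : complex) n : lmodType R :=
  subquot (cycles C n) (boundaries C n).

Definition exact_complex (C : complex) := forall n,
  {subset (cycles C n : {pred C n}) <= (boundaries C n : {pred C n})}.

Record cocomplex := Cocomplex {
  coobj :> nat -> lmodType R;
  codiff : forall n, {linear coobj n -> coobj n.+1};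
  codiffK : forall n x, codiff n.+1 (codiff n x) = 0 }.

Definition cocycles (C : cocomplex) n : submodClosed (C n) :=
  ker_sub (codiff C n).
Definition coboundaries (C : cocomplex) n : submodClosed (C n) :=
  match n with
  | 0 => zero_sub (C 0)
  | n.+1 => im_sub (codiff C n)
  end.

Definition cohomology (C : cocomplex) n : lmodType R :=
  subquot (cocycles C n) (coboundaries C n).

Fact hom_complex_subproof H (C : complex) n (h : Hom H (C n.+2)) :
  hom_post (cdiff C n) (hom_post (cdiff C n.+1) h) = 0.
Proof. by apply: hom_eqP => x; rewrite /hom_fun /= cdiffK. Qed.
Definition hom_complex H (C : complex) : complex :=
  @Complex (fun n => Hom H (C n)) (fun n => hom_post (cdiff C n))
    (@hom_complex_subproof H C).

Fact hom_cocomplex_subproof (C : complex) N n (h : Hom (C n) N) :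
  hom_pre (cdiff C n.+1) (hom_pre (cdiff C n) h) = 0.
Proof. by apply: hom_eqP => x; rewrite /hom_fun /= cdiffK [LHS]linear0. Qed.
Definition hom_cocomplex (C : complex) N : cocomplex :=
  @Cocomplex (fun n => Hom (C n) N) (fun n => hom_pre (cdiff C n))
    (@hom_cocomplex_subproof C N).

Fact tensor_complex_subproof (C : complex) N n (t : tensor (C n.+2) N) :
  @tensor_map _ _ N (cdiff C n) (@tensor_map _ _ N (cdiff C n.+1) t) = 0.
Proof.
rewrite -(quotpiK t) !tensor_mapE.
apply/eqP; rewrite -[0](linear0 (quotpi _)) quotpiE subr0.
rewrite -(freeg_sumE (repr t)) !linear_sum rpred_sum // => p _.
have -> c : << c *g p >> = c *: (<< p >> : {freeg (C n.+2 * N)%type / R}).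
  by apply/eqP/freeg_eqP => q; rewrite coeffZ !coeffU mul1r.
rewrite 2!linearZ rpredZ //= !free_mapE /= cdiffK; apply: mem_span.
have := @bilin_scalel _ _ 0 (0 : C n) p.2.
by rewrite !scale0r subr0.
Qed.
Definition tensor_complex (C : complex) N : complex :=
  @Complex (fun n => tensor (C n) N) (fun n => @tensor_map _ _ N (cdiff C n))
    (@tensor_complex_subproof C N).

Record augcomplex V := AugComplex {
  augbase :> complex;
  augm : {linear augbase 0 -> V};
  augmK : forall x, augm (cdiff augbase 0 x) = 0 }.

Section Augmented.
Variables (V : lmodType R) (P : augcomplex V).

Definition aug_obj n : lmodType R := if n is n.+1 then P n else V.
Definition aug_diff n : {linear aug_obj n.+1 -> aug_obj n} :=
  match n return {linear aug_obj n.+1 -> aug_obj n} with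
  | 0 => augm P
  | n.+1 => cdiff P n
  end.
Fact aug_diffK n x : aug_diff n (aug_diff n.+1 x) = 0.
Proof. by case: n x => [|n] x; [apply: augmK | apply: cdiffK]. Qed.

(* V sits in degree 0 and P n in degree n.+1, so exactness includes
   surjectivity of augm *)
Definition augmented : complex := Complex aug_diffK.
End Augmented.

Definition vanishes_above (C : complex) d :=
  forall n, (d < n)%N -> is_zero (C n).

Definition projective V := forall (X Y : lmodType R) (p : {linear X -> Y})
  (f : {linear V -> Y}), (forall y, exists x, p x = y) ->
  exists g : {linear V -> X}, forall v, p (g v) = f v.

Definition projective_resolution V (P : augcomplex V) :=
  exact_complex (augmented P) /\ forall n, projective (P n).

Definition pdim_le V d := exists P : augcomplex V,
  projective_resolution P /\ vanishes_above P d.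
Definition finite_pdim V := exists d, pdim_le V d.

Fact default_augcomplex_subproof V (n : nat) (x : V) :
  (\0 : {linear V -> V}) ((\0 : {linear V -> V}) x) = 0.
Proof. by []. Qed.
Definition default_augcomplex V : augcomplex V :=
  @AugComplex V (@Complex (fun=> V) (fun=> \0) (@default_augcomplex_subproof V))
    \0 (fun=> erefl).

(* Selects the resolution computing Tor, Ext and relative Tor; the default is
   reached only when no augmented complex satisfies A *)
Definition choose_aug V (A : augcomplex V -> Prop) : augcomplex V :=
  if pselect (exists P, A P) is left ex then projT1 (cid ex)
  else default_augcomplex V.

Definition projres V : augcomplex V := choose_aug (@projective_resolution V).

Definition Tor n V N : lmodType R := homology (tensor_complex (projres V) N) n.
Definition Ext n V N : lmodType R := cohomology (hom_cocomplex (projres V) N) n.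

Definition totally_reflexive V :=
  [/\ fin_gen V, bijective (@biduality V),
      forall i, i != 0%N -> is_zero (Ext i V R^o)
    & forall i, i != 0%N -> is_zero (Ext i (dual V) R^o)].

Definition G_resolution V (P : augcomplex V) :=
  exact_complex (augmented P) /\ forall n, totally_reflexive (P n).

Definition proper_resolution V (P : augcomplex V) := forall H : lmodType R,
  totally_reflexive H -> exact_complex (hom_complex H (augmented P)).

Definition Gdim_le V d := exists P : augcomplex V,
  G_resolution P /\ vanishes_above P d.
Definition finite_Gdim V := exists d, Gdim_le V d.

Definition properGres V : augcomplex V :=
  choose_aug (fun P => G_resolution P /\ proper_resolution P).

Definition TorG n V N : lmodType R :=
  homology (tensor_complex (properGres V) N) n.

Definition G_approximation V (K G : lmodType R)
    (f : {linear K -> G}) (g : {linear G -> V}) :=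
  [/\ [/\ fin_gen K, fin_gen G & fin_gen V],
      [/\ injective f, (forall y, g y = 0 <-> exists x, f x = y)
        & forall z, exists y, g y = z],
      totally_reflexive G & finite_pdim K].

Definition noetherian := forall I : submodClosed R^o, fin_gen (submod I).

Definition maximal_ideal (I : submodClosed R^o) :=
  1 \notin (I : {pred R^o}) /\
  forall J : submodClosed R^o,
    {subset (I : {pred R^o}) <= (J : {pred R^o})} ->
    1 \notin (J : {pred R^o}) ->
    (J : {pred R^o}) =i (I : {pred R^o}).

Definition local_ring (m : submodClosed R^o) :=
  maximal_ideal m /\
  forall I : submodClosed R^o, maximal_ideal I ->
    (I : {pred R^o}) =i (m : {pred R^o}).

Section Betti.
Variable m : submodClosed R^o.

Definition resfield : lmodType R := quotmod m.

(* k-vector spaces are the R-modules killed by m, and between them R-linear and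
   k-linear maps agree, so V has dimension n over k iff V ~ k^n over R *)
Definition dimk V : nat :=
  xget 0%N [set n | iso V {ffun 'I_n -> resfield}]%classic.

Definition betti n V : nat := dimk (Tor n V resfield).
Definition bettiG n V : nat := dimk (TorG n V resfield).

(* \sum_(n \in A) ranges over the finite support of the summand; it would be 0
   if that support were infinite *)
Definition chi V : int :=
  \sum_(n \in [set: nat]%classic) (-1) ^+ n * (betti n V)%:Z.
Definition chiG i V : int :=
  \sum_(n \in [set n | (i <= n)%N]%classic) (-1) ^+ (n - i) * (bettiG n V)%:Z.
End Betti.
End Modules.

Section Localization.
Variable R : comNzRingType.

Definition nzdiv : {pred R} := fun u => `[<forall x, u * x = 0 -> x = 0>].

Record denom := Denom {
  dval :> GRing.PzSemiRing.sort R;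
  denomP : dval \in nzdiv }.
HB.instance Definition _ := [isSub for dval].
HB.instance Definition _ := [Choice of denom by <:].

Fact den1_subproof : 1 \in nzdiv.
Proof. by rewrite unfold_in; apply/asboolP => x; rewrite mul1r. Qed.
Definition den1 := Denom den1_subproof.

Fact denM_subproof (u v : denom) : u * v \in nzdiv.
Proof.
have := denomP u; have := denomP v; rewrite !unfold_in.
move=> /asboolP vP /asboolP uP; apply/asboolP => x.
by rewrite -mulrA => /uP/vP.
Qed.
Definition denM u v := Denom (denM_subproof u v).

Section Module.
Variable V : lmodType R.
Implicit Types (x y : V) (u v w : denom).

(* (x, u) ~ (y, v) iff w (v x - u y) = 0 for some nonzerodivisor w; the factor
   w is needed because V may have torsion *)
Definition loc_rel (p q : V * denom) : bool :=
  `[<exists w : denom, (w * q.2) *: p.1 = (w * p.2) *: q.1>].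

Fact loc_rel_refl : reflexive loc_rel.
Proof. by move=> p; apply/asboolP; exists den1. Qed.
Fact loc_rel_sym : symmetric loc_rel.
Proof.
by move=> p q; apply/asboolP/asboolP => -[w e]; exists w; rewrite e.
Qed.
Fact loc_rel_trans : transitive loc_rel.
Proof.
move=> [y v] [x u] [z t] /asboolP[w /= e] /asboolP[w' /= e'].
apply/asboolP; exists (denM (denM w w') v) => /=.
have -> : w * w' * v * t = (w' * t) * (w * v) by ring.
rewrite -scalerA e scalerA.
have -> : w' * t * (w * u) = (w * u) * (w' * t) by ring.
by rewrite -scalerA e' scalerA; congr (_ *: _); ring.
Qed.
Canonical loc_equiv :=
  EquivRel loc_rel loc_rel_refl loc_rel_sym loc_rel_trans.

Definition loc := {eq_quot loc_equiv}.
HB.instance Definition _ := Choice.on loc.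
HB.instance Definition _ := EqQuotient.on loc.

Definition frac x u : loc := \pi_loc (x, u).

Lemma fracP x u y v :
  frac x u = frac y v <-> exists w : denom, (w * v) *: x = (w * u) *: y.
Proof.
rewrite /frac; split=> [/eqmodP/asboolP// | e].
by apply/eqmodP/asboolP.
Qed.

Lemma frac_eq x u y v : v *: x = u *: y -> frac x u = frac y v.
Proof. by move=> e; apply/fracP; exists den1; rewrite !mul1r. Qed.

Lemma fracK (a : loc) : frac (repr a).1 (repr a).2 = a.
Proof. by rewrite /frac -surjective_pairing reprK. Qed.

Variant frac_spec : loc -> Type := FracSpec x u : frac_spec (frac x u).
Lemma fracW a : frac_spec a. Proof. by rewrite -(fracK a). Qed.

Definition loc_add (a b : loc) : loc :=
  let p := repr a in let q := repr b in
  frac (q.2 *: p.1 + p.2 *: q.1) (denM p.2 q.2).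

Lemma loc_addE x u y v :
  loc_add (frac x u) (frac y v) =
  frac (v *: x + u *: y) (denM u v).
Proof.
rewrite /loc_add; set a := frac x u; set b := frac y v.
have /fracP[w e] := fracK a; have /fracP[w' e'] := fracK b.
case: (repr a) e => x1 u1 /= e; case: (repr b) e' => y1 v1 /= e'.
apply/fracP; exists (denM w w') => /=; rewrite !scalerDr !scalerA.
congr (_ + _).
- have -> : w * w' * (u * v) * v1 = (w' * v * v1) * (w * u) by ring.
  by rewrite -scalerA e scalerA; congr (_ *: _); ring.
- have -> : w * w' * (u * v) * u1 = (w * u * u1) * (w' * v) by ring.
  by rewrite -scalerA e' scalerA; congr (_ *: _); ring.
Qed.

Definition loc_opp (a : loc) : loc := frac (- (repr a).1) (repr a).2.
Lemma loc_oppE x u : loc_opp (frac x u) = frac (- x) u.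
Proof.
rewrite /loc_opp; have /fracP[w e] := fracK (frac x u).
by apply/fracP; exists w; rewrite !scalerN e.
Qed.

Definition loc0 : loc := frac 0 den1.

Fact loc_addA : associative loc_add.
Proof.
move=> a b c; case: (fracW a) => x u; case: (fracW b) => y v.
case: (fracW c) => z t; rewrite !loc_addE; apply: frac_eq => /=.
rewrite !scalerDr !scalerA -addrA.
by congr (_ *: _ + (_ *: _ + _ *: _)); ring.
Qed.
Fact loc_addC : commutative loc_add.
Proof.
move=> a b; case: (fracW a) => x u; case: (fracW b) => y v.
rewrite !loc_addE; apply: frac_eq => /=.
by rewrite addrC mulrC.
Qed.
Fact loc_add0 : left_id loc0 loc_add.
Proof.
move=> a; case: (fracW a) => x u.
by rewrite loc_addE; apply: frac_eq; rewrite /= scaler0 add0r scale1r mul1r.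
Qed.
Fact loc_addN : left_inverse loc0 loc_opp loc_add.
Proof.
move=> a; case: (fracW a) => x u; rewrite loc_oppE loc_addE.
by apply: frac_eq; rewrite /= scalerN addNr !scaler0.
Qed.
HB.instance Definition _ :=
  GRing.isZmodule.Build loc loc_addA loc_addC loc_add0 loc_addN.

Lemma fracD x u y v :
  frac x u + frac y v = frac (v *: x + u *: y) (denM u v).
Proof. exact: loc_addE. Qed.
End Module.

Definition loc_mul (V : lmodType R) (a : loc R^o) (b : loc V) : loc V :=
  let p := repr a in let q := repr b in
  frac (p.1 *: q.1) (denM p.2 q.2).

Lemma loc_mulE (V : lmodType R) (r : R^o) (u : denom) (x : V) (v : denom) :
  loc_mul (frac r u) (frac x v) = frac ((r : R) *: x) (denM u v).
Proof.
rewrite /loc_mul; set a := frac r u; set b := frac x v.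
have /fracP[w e] := fracK a; have /fracP[w' e'] := fracK b.
case: (repr a) e => r1 u1 /= e; case: (repr b) e' => x1 v1 /= e'.
apply/fracP; exists (denM w w') => /=; rewrite !scalerA.
have e1 : w * u * r1 = w * u1 * r := e.
have -> : w * w' * (u * v) * r1 = (w * u * r1) * (w' * v) by ring.
by rewrite -scalerA e' e1 scalerA; congr (_ *: _); ring.
Qed.

Section LocMul.
Variable V : lmodType R.
Local Notation mul := (@loc_mul V).

Fact loc_mulA a b c : mul a (mul b c) = mul (loc_mul a b) c.
Proof.
case: (fracW a) => r u; case: (fracW b) => s v; case: (fracW c) => x w.
rewrite (loc_mulE s v x) (loc_mulE r u s) !loc_mulE.
apply: frac_eq => /=; rewrite !scalerA.
have e (k l n d f : R) : k * l * n * d * f = k * (l * n) * (d * f) by ring.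
by congr (_ *: _); apply: e.
Qed.
Fact loc_mul1 : left_id (frac 1 den1 : loc R^o) mul.
Proof.
move=> a; case: (fracW a) => x u; rewrite loc_mulE.
by apply: frac_eq; rewrite /= scale1r mul1r.
Qed.
Fact loc_mulDr : right_distributive mul +%R.
Proof.
move=> a b c; case: (fracW a) => r u; case: (fracW b) => x v.
case: (fracW c) => y w.
rewrite fracD (loc_mulE r u x) (loc_mulE r u y) fracD loc_mulE.
apply: frac_eq => /=; rewrite !scalerDr !scalerA.
by congr (_ *: _ + _ *: _); ring.
Qed.
Fact loc_mulDl c : {morph mul^~ c : a b / a + b}.
Proof.
move=> a b; case: (fracW a) => r u; case: (fracW b) => s v.
case: (fracW c) => x w.
rewrite fracD (loc_mulE r u x) (loc_mulE s v x) fracD loc_mulE.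
apply: frac_eq => /=; rewrite scalerDl !scalerDr !scalerA.
have e (k l n d : R) : k * n * (l * n) * (l * d) = k * l * n * (l * n) * d.
  by ring.
have e' (k l n d : R) : k * n * (l * n) * (k * d) = k * l * n * (k * n) * d.
  by ring.
by congr (_ *: _ + _ *: _); [apply: e | apply: e'].
Qed.
End LocMul.

Definition total_frac := loc R^o.
HB.instance Definition _ := GRing.Zmodule.on total_frac.

Fact loc_mulC : commutative (@loc_mul R^o).
Proof.
move=> a b; case: (fracW a) => r u; case: (fracW b) => s v.
rewrite !loc_mulE; apply: frac_eq; rewrite /GRing.scale /=; ring.
Qed.
Fact loc_1neq0 : (frac 1 den1 : total_frac) != 0.
Proof.
apply/eqP => /fracP[w]; rewrite scaler0 mulr1.
rewrite /GRing.scale /= mulr1 => w0.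
have := denomP w; rewrite unfold_in => /asboolP/(_ 1).
by rewrite w0 mul0r => /(_ erefl)/eqP; rewrite oner_eq0.
Qed.
HB.instance Definition _ := GRing.Zmodule_isComNzRing.Build total_frac
  (@loc_mulA R^o) loc_mulC (@loc_mul1 R^o)
  (fun a b c => @loc_mulDl R^o c a b) loc_1neq0.

HB.instance Definition _ (V : lmodType R) :=
  GRing.Zmodule_isLmodule.Build total_frac (loc V)
    (@loc_mulA V) (@loc_mul1 V) (@loc_mulDr V) (@loc_mulDl V).

Definition has_rank (V : lmodType R) (r : nat) :=
  @iso total_frac (loc V) 'rV[total_frac]_r.
End Localization.

(* Main.v *)
(* Splicing the minimal free resolution F of K with G gives a bounded complex
   over M. For H totally reflexive, Ext^i(H, -) vanishes on free modules for
   i > 0, so dimension shifting along F shows that Hom(H, -) is exact on it: the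
   splice is a proper G-resolution. Since F is minimal, tensoring with k gives
     beta^G_n(M) = rank F_(n-1)  for n >= 2,
   together with an exact sequence
     0 -> Tor^G_1(M, k) -> F_0 (x) k -> G (x) k -> M (x) k -> 0.
   Hence chi^G_i(M) is the tail of the Euler characteristic of F starting at
   F_(i-1) for i >= 2, and chi^G(M) = beta_0(G) - chi(K).

   For the inequalities, choose x <> 0 whose annihilator p is prime. An R-linear
   system which is injective up to a denominator outside p stays injective over
   the fraction field of R/p, because multiplication by x kills exactly p; so F
   becomes split exact there, the tails of its Euler characteristic are
   dimensions of complements, and chi(K) + r generically independent elements
   of G force beta_0(G) >= chi(K) + r when R^r embeds in M. *)

Require Import Defs.
From HB Require Import structures.
From mathcomp Require Import all_boot all_order all_algebra.
From mathcomp Require Import generic_quotient ring_quotient fraction.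
From mathcomp Require Import boolp classical_sets functions fsbigop.
From mathcomp Require Import freeg ring.

Set Implicit Arguments.
Unset Strict Implicit.
Unset Printing Implicit Defensive.

Import Order.TTheory GRing.Theory Num.Theory.
Local Open Scope ring_scope.
Local Open Scope quotient_scope.

(** * Linear maps and free modules *)

(** Sequences whose terms live in varying types, such as chain maps and homotopies, are built with
    this. [Good] is the invariant under which a next term exists; the recursion runs on terms paired
    with a proof of [Good]. *)
Lemma dependent_choice (T : nat -> Type) (Good : forall n, T n -> Prop)
    (step : forall n, T n -> T n.+1 -> Prop) (x0 : T 0) :
  Good 0 x0 ->
  (forall n x, Good n x -> exists2 y, Good n.+1 y & step n x y) ->
  exists s : forall n, T n, [/\ s 0 = x0, forall n, Good n (s n)
    & forall n, step n (s n) (s n.+1)].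
Proof.
move=> G0 next.
have nextT n (x : {x | Good n x}) :
    {y : {y | Good n.+1 y} | step n (sval x) (sval y)}.
  apply: cid; case: x => x Gx /=.
  by have [y Gy xy] := next n x Gx; exists (exist _ y Gy).
pose s := fix s n : {x | Good n x} :=
  match n with 0 => exist _ x0 G0 | n.+1 => sval (nextT n (s n)) end.
exists (fun n => sval (s n)); split=> // n; first exact: svalP.
exact: svalP (nextT n (s n)).
Qed.

Section LinearMaps.
Variable R : comNzRingType.
Implicit Types U V W : lmodType R.

Lemma linear_exists U V (f : U -> V) : linear f ->
  exists g : {linear U -> V}, g =1 f.
Proof.
move=> lf; pose L := GRing.isLinear.Build R U V *:%R f lf.
by exists (HB.pack f L : {linear U -> V}).
Qed.

Definition onto U V (f : U -> V) := forall y, exists x, f x = y.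

Lemma linear_bij U V (f : {linear U -> V}) :
  (forall x, f x = 0 -> x = 0) -> onto f -> bijective f.
Proof.
move=> f0 fs; have fi : injective f.
  by move=> x y fxy; apply/eqP; rewrite -subr_eq0; apply/eqP/f0;
    rewrite linearB fxy subrr.
exists (fun y => projT1 (cid (fs y))) => [x|y]; last by case: cid.
by apply: fi; case: cid.
Qed.

Lemma inverse_linear U V (f : {linear U -> V}) : bijective f ->
  exists g : {linear V -> U}, cancel f g /\ cancel g f.
Proof.
case=> g fK gK; have lg : linear g.
  by move=> a x y; apply: (can_inj fK); rewrite linearP !gK.
by have [h hg] := linear_exists lg; exists h; split=> x; rewrite hg.
Qed.

Lemma factor_onto U V W (q : {linear U -> V}) (f : {linear U -> W}) :
  onto q -> (forall x, q x = 0 -> f x = 0) ->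
  exists g : {linear V -> W}, forall x, g (q x) = f x.
Proof.
move=> qs qf; pose g y := f (projT1 (cid (qs y))).
have gE x : g (q x) = f x.
  rewrite /g; case: cid => z /= qz; apply/eqP; rewrite -subr_eq0 -linearB.
  by apply/eqP/qf; rewrite linearB qz subrr.
have lg : linear g.
  move=> a x y; have [u <-] := qs x; have [v <-] := qs y.
  by rewrite -linearP !gE linearP.
by have [h hg] := linear_exists lg; exists h => x; rewrite hg gE.
Qed.

Lemma factor_inj U V W (i : {linear U -> V}) (f : {linear W -> V}) :
  injective i -> (forall x, exists y, i y = f x) ->
  exists g : {linear W -> U}, forall x, i (g x) = f x.
Proof.
move=> ii fi; pose g x := projT1 (cid (fi x)).
have gE x : i (g x) = f x by rewrite /g; case: cid.
have lg : linear g by move=> a x y; apply: ii; rewrite linearP !gE linearP.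
by have [h hg] := linear_exists lg; exists h => x; rewrite hg gE.
Qed.

Lemma corestriction U V (f : {linear U -> V}) (S : submodClosed V) :
  (forall x, f x \in (S : {pred V})) ->
  exists g : {linear U -> submod S}, forall x, smval (g x) = f x.
Proof.
move=> fS; have lg : linear (fun x => SubMod (fS x)).
  by move=> a x y; apply: val_inj; rewrite /= linearP.
by have [g gE] := linear_exists lg; exists g => x; rewrite gE.
Qed.

Lemma im_subP U V (f : {linear U -> V}) y :
  reflect (exists x, f x = y) (y \in (im_sub f : {pred V})).
Proof. exact: asboolP. Qed.

Lemma ker_subP U V (f : {linear U -> V}) x :
  reflect (f x = 0) (x \in (ker_sub f : {pred U})).
Proof. exact: eqP. Qed.

Lemma quotpi_eq0P V (S : submodClosed V) x :
  reflect (quotpi S x = 0) (x \in (S : {pred V})).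
Proof. by rewrite -[x in x \in _]subr0 -quotpiE linear0; apply: eqP. Qed.

Lemma quotpi_onto V (S : submodClosed V) : onto (quotpi S).
Proof. by move=> q; exists (repr q); apply: quotpiK. Qed.

End LinearMaps.

Section FreeModules.
Variable R : comNzRingType.
Implicit Types U V W : lmodType R.

Lemma row_basis_map V n (e : 'I_n -> V) :
  exists phi : {linear 'rV[R]_n -> V}, forall a, phi a = \sum_i a 0 i *: e i.
Proof.
apply: linear_exists => a x y; rewrite scaler_sumr -big_split /=.
by apply: eq_bigr => i _; rewrite !mxE scalerDl scalerA.
Qed.

Lemma row_map_ex V n (e : 'I_n -> V) :
  exists phi : {linear 'rV[R]_n -> V}, forall i, phi (delta_mx 0 i) = e i.
Proof.
have [phi phiE] := row_basis_map e; exists phi => i.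
rewrite phiE (bigD1 i) //= big1 => [|j ji].
  by rewrite mxE !eqxx scale1r addr0.
by rewrite mxE eqxx (negbTE ji) scale0r.
Qed.

Lemma row_mapE V n (phi : {linear 'rV[R]_n -> V}) a :
  phi a = \sum_i a 0 i *: phi (delta_mx 0 i).
Proof. by rewrite [a in LHS]row_sum_delta linear_sum; apply: eq_bigr => i _;
  rewrite linearZ. Qed.

Lemma fin_genP V :
  fin_gen V <-> exists n (phi : {linear 'rV[R]_n -> V}), onto phi.
Proof.
split=> [[n [e eP]]|[n [phi phis]]].
  have [phi phiE] := row_basis_map e; exists n, phi => x.
  have [a ->] := eP x; exists (\row_i a i); rewrite phiE.
  by apply: eq_bigr => i _; rewrite mxE.
exists n, (fun i => phi (delta_mx 0 i)) => x; have [a <-] := phis x.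
by exists (a 0); apply: row_mapE.
Qed.

Lemma row_projective n : projective ('rV[R]_n : lmodType R).
Proof.
move=> X Y p f ps; pose e i := projT1 (cid (ps (f (delta_mx 0 i)))).
have eE i : p (e i) = f (delta_mx 0 i) by rewrite /e; case: cid.
have [g gE] := row_map_ex e; exists g => v.
rewrite (row_mapE g) linear_sum (row_mapE f); apply: eq_bigr => i _.
by rewrite linearZ gE eE.
Qed.

Lemma projective_iso U V (f : {linear U -> V}) :
  bijective f -> projective U -> projective V.
Proof.
move=> /inverse_linear[g [fK gK]] pU X Y p h ps.
have [k kE] := pU X Y p (h \o f) ps; exists (k \o g) => v /=.
by rewrite kE /= gK.
Qed.

Lemma fin_gen_onto U V (f : {linear U -> V}) :
  onto f -> fin_gen U -> fin_gen V.
Proof.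
move=> fs /fin_genP[n [phi phis]]; apply/fin_genP; exists n, (f \o phi) => y.
by have [x <-] := fs y; have [a <-] := phis x; exists a.
Qed.

Lemma lin1_mxE n p (d : {linear 'rV[R]_n -> 'rV[R]_p}) v : d v = v *m lin1_mx d.
Proof. by rewrite mul_rV_lin1. Qed.

(** [projective] lifts along surjections only, so both maps are first corestricted to the image of
    [f]. *)
Lemma projective_lift (P V W : lmodType R) (f : {linear V ->
  W}) (h : {linear P -> W}) :
  projective P -> (forall x, exists y, f y = h x) ->
  exists g : {linear P -> V}, forall x, f (g x) = h x.
Proof.
move=> pP fh; have fim x : f x \in (im_sub f : {pred W}) by apply/im_subP;
  exists x.
have him x : h x \in (im_sub f : {pred W}) by apply/im_subP.
have [f' f'E] := corestriction fim; have [h' h'E] := corestriction him.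
have f's : onto f'.
  by case=> y Sy; have /im_subP[x fx] := Sy; exists x; apply: val_inj;
    rewrite /= f'E.
have [g gE] := pP _ _ f' h' f's; exists g => x.
by rewrite -f'E gE h'E.
Qed.

End FreeModules.

(** * Noetherian modules and rings *)

Section Noetherian.
Variable R : comNzRingType.
Implicit Types U V W : lmodType R.

Lemma submod_exists V (A : V -> Prop) : A 0 ->
  (forall x y, A x -> A y -> A (x + y)) -> (forall a x, A x -> A (a *: x)) ->
  exists S : submodClosed V, forall x, x \in (S : {pred V}) <-> A x.
Proof.
move=> A0 AD AZ; pose P : {pred V} := fun x => `[<A x>].
have P_closed : GRing.subsemimod_closed P.
  split; [split=> [|x y] | move=> a x]; rewrite !unfold_in.
  - exact/asboolP.
  - by move=> /asboolP Ax /asboolP Ay; apply/asboolP/AD.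
  - by move=> /asboolP Ax; apply/asboolP/AZ.
pose L := GRing.isSubSemiModClosed.Build R V P P_closed.
exists (HB.pack P L : submodClosed V) => x.
by split=> [/asboolP|Ax] //; apply/asboolP.
Qed.

(** Finite generation is phrased inside [V] rather than on the subtype [submod S], so that it is
    easily carried along linear maps. *)
Definition fg_sub V (S : submodClosed V) :=
  exists n (phi : {linear 'rV[R]_n -> V}),
    forall x, x \in (S : {pred V}) <-> exists a, phi a = x.

Definition noetherian_module V := forall S : submodClosed V, fg_sub S.

Lemma noetherian_regular : noetherian R -> noetherian_module R^o.
Proof.
move=> nR S; have /fin_genP[n [phi phis]] := nR S.
have lv : linear (fun a => smval (phi a)) by move=> a x y; rewrite linearP.
have [g gE] := linear_exists lv; exists n, g => x; split=> [Sx|[a <-]].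
  by have [a aE] := phis (SubMod Sx); exists a; rewrite gE aE.
by rewrite gE; case: (phi a).
Qed.

Lemma noetherian_inj U V (f : {linear U -> V}) :
  injective f -> noetherian_module V -> noetherian_module U.
Proof.
move=> fi nV S.
have [|x y|a x|T TE] := @submod_exists V (fun y => exists2 x,
  x \in (S : {pred U}) & f x = y).
- by exists 0; rewrite ?rpred0 ?linear0.
- by move=> [u Su <-] [v Sv <-]; exists (u + v); rewrite ?rpredD ?linearD.
- by move=> [u Su <-]; exists (a *: u); rewrite ?rpredZ ?linearZ.
have [n [phi phiE]] := nV T.
have fphi a : exists x, f x = phi a.
  have /TE[u _ <-] : phi a \in (T : {pred V}) by apply/phiE; exists a.
  by exists u.
have [g gE] := factor_inj fi fphi; exists n, g => x; split=> [Sx|[a <-]].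
  have [|a aE] := (phiE (f x)).1; first by apply/TE; exists x.
  by exists a; apply: fi; rewrite gE.
have /TE[u Su] : phi a \in (T : {pred V}) by apply/phiE; exists a.
by rewrite -gE => /fi <-.
Qed.

Lemma noetherian_onto U V (f : {linear U -> V}) :
  onto f -> noetherian_module U -> noetherian_module V.
Proof.
move=> fs nU S; have [n [phi phiE]] := nU (preim_sub f S).
exists n, (f \o phi) => y; split=> [Sy|[a <-]].
  have [x fx] := fs y; have [|a aE] := (phiE x).1;
    first by rewrite mem_preim fx.
  by exists a; rewrite /= aE.
by have : phi a \in (preim_sub f S : {pred U}) by apply/phiE; exists a.
Qed.

(** Generators of [S] are lifts of generators of its image in [W], together with generators of its
    intersection with the kernel of [f]. *)
Lemma noetherian_extension V W (f : {linear V -> W}) :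
  noetherian_module (submod (ker_sub f)) -> noetherian_module W ->
  noetherian_module V.
Proof.
move=> nK nW S.
have [|x y|a x|T TE] := @submod_exists W (fun y => exists2 x,
  x \in (S : {pred V}) & f x = y).
- by exists 0; rewrite ?rpred0 ?linear0.
- by move=> [u Su <-] [v Sv <-]; exists (u + v); rewrite ?rpredD ?linearD.
- by move=> [u Su <-]; exists (a *: u); rewrite ?rpredZ ?linearZ.
have [n [phi phiE]] := nW T.
have Tphi i : exists2 x, x \in (S : {pred V}) & f x = phi (delta_mx 0 i).
  by apply/TE/phiE; eexists.
pose e i := projT1 (cid2 (Tphi i)).
have eS i : e i \in (S : {pred V}) by rewrite /e; case: cid2.
have eE i : f (e i) = phi (delta_mx 0 i) by rewrite /e; case: cid2.
have [psi psiE] := row_map_ex e.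
have psiS a : psi a \in (S : {pred V}).
  by rewrite row_mapE rpred_sum // => i _; rewrite rpredZ ?psiE.
have fpsi a : f (psi a) = phi a.
  rewrite (row_mapE psi) linear_sum (row_mapE phi); apply: eq_bigr => i _.
  by rewrite linearZ psiE eE.
have lv : linear (@smval _ _ (ker_sub f)) by move=> a x y.
have [j jE] := linear_exists lv.
have [p [chi chiE]] := nK (preim_sub j S).
have lg : linear (fun v : 'rV_(n + p) => psi (lsubmx v) + j (chi (rsubmx v))).
  by move=> a x y; rewrite !linearP /= scalerDr addrACA.
have [g gE] := linear_exists lg; exists (n + p)%N, g => x.
split=> [Sx|[a <-]]; last first.
  rewrite gE rpredD //.
  by have : chi (rsubmx a) \in (preim_sub j S : {pred _}) by apply/chiE;
    eexists.
have [|a aE] := (phiE (f x)).1; first by apply/TE; exists x.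
have Kx : x - psi a \in (ker_sub f : {pred V}).
  by apply/ker_subP; rewrite linearB fpsi aE subrr.
have [|b bE] := (chiE (SubMod Kx)).1.
  by rewrite mem_preim jE /= -scaleN1r rpredD ?rpredZ.
exists (row_mx a b); rewrite gE row_mxKl row_mxKr bE jE /=.
by rewrite addrC subrK.
Qed.

(** Induction on [n], splitting off the first coordinate: the remaining coordinates are injective on
    the kernel of [lsubmx]. *)
Lemma noetherian_row n : noetherian R -> noetherian_module 'rV[R]_n.
Proof.
move=> nR; elim: n => [|n IHn].
  by move=> S; exists 0%N, idfun => x; split=> [_|_];
    [exists x | rewrite thinmx0 rpred0].
apply: (@noetherian_extension 'rV[R]_(1 + n) 'rV[R]_1 lsubmx).
  have lr : linear (fun x : submod (ker_sub
    (lsubmx : {linear 'rV[R]_(1 + n) -> 'rV_1}))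
              => rsubmx (smval x)).
    by move=> a x y; rewrite /= linearP.
  have [r rE] := linear_exists lr; apply: (noetherian_inj (f := r)) IHn.
  move=> x y; rewrite !rE => xy; apply: val_inj;
    rewrite /= -[LHS]hsubmxK -[RHS]hsubmxK.
  rewrite xy; case: x {xy} => x /= /ker_subP ->.
  by case: y => y /= /ker_subP ->.
have lc : linear (fun x : R^o => x%:M : 'rV[R]_1).
  by move=> a x y; rewrite raddfD /= -scale_scalar_mx.
have [c cE] := linear_exists lc; apply: (noetherian_onto (f := c));
  last exact: noetherian_regular.
by move=> x; exists (x 0 0); rewrite cE -mx11_scalar.
Qed.

Lemma noetherian_fin_gen V : noetherian R -> fin_gen V -> noetherian_module V.
Proof.
move=> nR /fin_genP[n [phi phis]].
by apply: noetherian_onto phis _; apply: noetherian_row.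
Qed.

Lemma fin_gen_submod V (S : submodClosed V) : fg_sub S -> fin_gen (submod S).
Proof.
move=> [n [phi phiE]].
have pS a : phi a \in (S : {pred V}) by apply/phiE; exists a.
have [g gE] := corestriction pS; apply/fin_genP; exists n, g => -[x Sx].
have [a aE] := (phiE x).1 Sx; exists a; apply: val_inj.
by rewrite /= gE.
Qed.

(** Without a maximal member, dependent choice produces a strictly increasing chain in [F]. Its
    union is finitely generated, so it equals some member [s N], which contradicts that [s N.+1] is
    larger. *)
Lemma noetherian_maximal (F : submodClosed R^o ->
  Prop) (I0 : submodClosed R^o) :
  noetherian R -> F I0 ->
  exists2 I, F I & forall J, F J ->
    {subset (I : {pred R^o}) <= (J : {pred R^o})} ->
    {subset (J : {pred R^o}) <= (I : {pred R^o})}.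
Proof.
move=> nR FI0; apply: contrapT => nomax.
pose leI (I J : submodClosed R^o) := {subset (I : {pred R^o}) <=
  (J : {pred R^o})}.
have [|n I FI|s [s0 sF sS]] := @dependent_choice (fun=> submodClosed R^o)
  (fun _ => F) (fun _ I J => leI I J /\ ~ leI J I) I0.
- exact: FI0.
- apply: contrapT => nI; apply: nomax; exists I => // J FJ IJ.
  by apply: contrapT => nJI; apply: nI; exists J.
have smono i k : leI (s i) (s (i + k)%N).
  elim: k => [|k IHk]; first by rewrite addn0.
  by move=> x /IHk; rewrite addnS; apply: (sS _).1.
have [|x y|a x|U UE] := @submod_exists R^o (fun x => exists i,
  x \in (s i : {pred _})).
- by exists 0%N; rewrite rpred0.
- move=> [i xi] [k yk]; exists (i + k)%N; rewrite rpredD //; first exact: smono.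
  by rewrite addnC; apply: smono.
- by move=> [i xi]; exists i; rewrite rpredZ.
have [n [phi phiE]] := noetherian_regular nR U.
have gen i : exists k, phi (delta_mx 0 i) \in (s k : {pred R^o}).
  by apply/UE/phiE; eexists.
pose k i := projT1 (cid (gen i)).
have kE i : phi (delta_mx 0 i) \in (s (k i) : {pred R^o}) by rewrite /k;
  case: cid.
pose N := (\max_i k i)%N.
apply: (sS N).2 => x xN1.
have [|a <-] := (phiE x).1; first by apply/UE; exists N.+1.
rewrite row_mapE rpred_sum // => i _; rewrite rpredZ //.
by rewrite -(subnKC (leq_bigmax i : k i <= N)%N); apply: smono.
Qed.

(** If the ideal of multiples of [a] were proper, an ideal maximal among the proper ones containing
    [a] would be a maximal ideal, hence equal to [m], which omits [a]. Noetherianity takes the place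
    of Zorn's lemma. *)
Lemma notin_maximal_unit (m : submodClosed R^o) (a : R) :
  noetherian R -> local_ring m -> a \notin (m : {pred R^o}) ->
  exists b, b * a = 1.
Proof.
move=> nR [_ mU] am.
have [|x y|c x|A AE] := @submod_exists R^o (fun x => exists b : R, b * a = x).
- by exists 0; rewrite mul0r.
- by move=> [b <-] [c <-]; exists (b + c); rewrite mulrDl.
- by move=> [b <-]; exists (c * b); rewrite -mulrA.
apply/AE; apply/idPn => nA1.
have Aa : a \in (A : {pred R^o}) by apply/AE; exists 1; rewrite mul1r.
have [I [I1 Ia] Imax] := @noetherian_maximal
  (fun I => (1 \notin (I : {pred R^o})) /\ (a \in (I : {pred R^o}))) A nR
    (conj nA1 Aa).
have Im : maximal_ideal I.
  split=> // J IJ J1 x; apply/idP/idP; last exact: IJ.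
  by apply: Imax => //; split=> //; apply: IJ.
by move: am; rewrite -(mU _ Im) Ia.
Qed.

Lemma maximal_ideal_prime (m : submodClosed R^o) (a b : R) :
  noetherian R -> local_ring m ->
  a * b \in (m : {pred R^o}) ->
  a \in (m : {pred R^o}) \/ b \in (m : {pred R^o}).
Proof.
move=> nR lR abm; have [am|/(notin_maximal_unit nR lR)[c ca]] :=
  boolP (a \in (m : {pred R^o})).
  by left.
right; rewrite -[b]mul1r -ca -mulrA.
exact: (@rpredZ _ _ (m : submodClosed R^o) c).
Qed.

(* A maximal annihilator of a nonzero element is prime *)
Lemma prime_annihilator : noetherian R ->
  exists2 x : R, x != 0 & forall a b, x * (a * b) = 0 -> x * a = 0 \/ x * b = 0.
Proof.
move=> nR.
have annE (x : R) : exists I : submodClosed R^o, forall a : R,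
  a \in (I : {pred R^o}) <-> x * a = 0.
  apply: (@submod_exists R^o (fun a : R => x * a = 0)) => [|a b xa xb|a b xb].
  - by rewrite mulr0.
  - by rewrite mulrDr xa xb addr0.
  - by rewrite /GRing.scale /= mulrCA xb mulr0.
have [I1 I1E] := annE 1.
have [|I [x [x0 xI]] Imax] := @noetherian_maximal (fun I => exists x, x != 0 /\
    forall a : R, a \in (I : {pred R^o}) <-> x * a = 0) I1 nR.
  by exists 1; rewrite oner_neq0.
exists x => // a b xab; have [xa|/eqP xa] := eqVneq (x * a) 0; [by left|right].
(* The annihilator of [x * a] contains that of [x], so maximality makes them equal, and [b] belongs
   to the former. *)
have [J JE] := annE (x * a).
apply/xI/(Imax J).
- by exists (x * a); split=> //; apply/eqP.
- by move=> c /xI xc; apply/JE; rewrite mulrAC xc mul0r.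
- by apply/JE; rewrite -mulrA.
Qed.

End Noetherian.

(** * The fraction field of R/p *)

Lemma frac_mul_denom (D : idomainType) (z : {ratio D}) :
  (\pi_{fraction D} z : {fraction D}) * FracField.tofrac \d_z =
    FracField.tofrac \n_z.
Proof.
unlock FracField.tofrac; rewrite -[LHS]FracField.pi_mul; apply/eqmodP.
rewrite /= /FracField.equivf /FracField.mulf !numden_Ratio ?mulf_neq0
  ?oner_eq0 ?denom_ratioP //.
by rewrite !mulr1 mulrC.
Qed.

Section PrimeQuotient.
Variables (R : comNzRingType) (I : prime_idealr R).

Definition prime_quot := {ideal_quot I}.
HB.instance Definition _ := Choice.on prime_quot.
HB.instance Definition _ := GRing.ComNzRing.on prime_quot.

(** Fractions are formed over an integral domain, whose structure includes an inverse. The inverse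
    is chosen classically, and non-units are sent to themselves as the structure demands. *)
Definition prime_quot_unit : {pred prime_quot} :=
  fun x => `[<exists y, y * x = 1>].
Definition prime_quot_inv (x : prime_quot) : prime_quot :=
  if pselect (exists y, y * x = 1) is left ex then projT1 (cid ex) else x.

Fact prime_quot_mulVx : {in prime_quot_unit, left_inverse 1 prime_quot_inv *%R}.
Proof.
move=> x /asboolP xu; rewrite /prime_quot_inv; case: pselect => [ex|/(_ xu)//].
by case: cid.
Qed.
Fact prime_quot_unitPl (x y : prime_quot) : y * x = 1 -> prime_quot_unit x.
Proof. by move=> yx; apply/asboolP; exists y. Qed.
Fact prime_quot_invx : {in [predC prime_quot_unit], prime_quot_inv =1 id}.
Proof.
move=> x; rewrite inE /= => /asboolP xu.
by rewrite /prime_quot_inv; case: pselect.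
Qed.
HB.instance Definition _ := GRing.ComNzRing_hasMulInverse.Build prime_quot
  prime_quot_mulVx prime_quot_unitPl prime_quot_invx.

Fact prime_quot_integral (x y : prime_quot) : x * y = 0 -> (x == 0) || (y == 0).
Proof. exact: Quotient.rquot_IdomainAxiom. Qed.
HB.instance Definition _ :=
  GRing.ComUnitRing_isIntegral.Build prime_quot prime_quot_integral.

Definition prime_quot_pi (a : R) : {fraction prime_quot} :=
  FracField.tofrac (\pi_{ideal_quot I} a : prime_quot).

Fact prime_quot_pi_zmod : zmod_morphism prime_quot_pi.
Proof.
move=> a b; rewrite /prime_quot_pi -tofracB; congr (FracField.tofrac _).
exact: (rmorphB (\pi_{ideal_quot I})).
Qed.
Fact prime_quot_pi_monoid : monoid_morphism prime_quot_pi.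
Proof.
split=> [|a b]; rewrite /prime_quot_pi.
  by rewrite -[RHS]tofrac1; congr (FracField.tofrac _);
    apply: (rmorph1 (\pi_{ideal_quot I})).
by rewrite -tofracM; congr (FracField.tofrac _);
  apply: (rmorphM (\pi_{ideal_quot I})).
Qed.
HB.instance Definition _ := GRing.isZmodMorphism.Build R {fraction prime_quot}
  prime_quot_pi prime_quot_pi_zmod.
HB.instance Definition _ := GRing.isMonoidMorphism.Build R {fraction prime_quot}
  prime_quot_pi prime_quot_pi_monoid.

Lemma prime_quot_pi_eq0 a : (prime_quot_pi a == 0) = (a \in I).
Proof.
rewrite /prime_quot_pi tofrac_eq0 -[a in RHS]subr0 Quotient.idealrBE.
congr (_ == _); exact/esym/(rmorph0 (\pi_{ideal_quot I})).
Qed.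

Lemma prime_quot_pi_frac z : exists a b,
  prime_quot_pi b != 0 /\ z = prime_quot_pi a / prime_quot_pi b.
Proof.
elim/quotW: z => z.
have [a aE] : exists a, \pi_{ideal_quot I} a = (\n_z : {ideal_quot I})
  by exists (repr \n_z); apply: reprK.
have [b bE] : exists b, \pi_{ideal_quot I} b = (\d_z : {ideal_quot I})
  by exists (repr \d_z); apply: reprK.
have b0 : prime_quot_pi b != 0 by rewrite /prime_quot_pi tofrac_eq0 bE
  denom_ratioP.
exists a, b; split=> //.
apply: (mulIf b0); rewrite divfK // /prime_quot_pi aE bE.
exact: frac_mul_denom.
Qed.

End PrimeQuotient.

Section ResidueField.
Variable R : comNzRingType.

(** The field is the fraction field of the quotient by the prime ideal [P]; only its kernel and the
    shape of its elements are retained. It is applied to [m] and to a prime annihilator. *)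
Lemma prime_field (P : R -> Prop) :
  (forall a b, P a -> P b -> P (a + b)) -> (forall a b, P b -> P (a * b)) ->
  P 0 -> ~ P 1 -> (forall a b, P (a * b) -> P a \/ P b) ->
  exists (F : fieldType) (pi : {rmorphism R -> F}),
    (forall a, pi a = 0 <-> P a) /\
    forall z, exists a b, pi b != 0 /\ z = pi a / pi b.
Proof.
move=> PD PM P0 P1 Pprime; pose I : {pred R} := fun a => `[<P a>].
have I_ideal : idealr_closed I.
  split=> [||a u v]; rewrite ?unfold_in; [exact/asboolP | exact/asboolP |].
  by move=> /asboolP Pu /asboolP Pv; apply/asboolP/PD => //; apply: PM.
have I_prime : prime_idealr_closed I.
  move=> a b; rewrite !unfold_in => /asboolP/Pprime Pab; apply/orP.
  by case: Pab => ?; [left|right]; apply/asboolP.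
pose L1 := isIdealr.Build R I I_ideal.
pose L3 := isPrimeIdealrClosed.Build R I I_prime.
pose PI : prime_idealr R := HB.pack I L1 L3.
exists {fraction (prime_quot PI)}, (@prime_quot_pi R PI : {rmorphism _ -> _}).
split=> [a|]; last exact: prime_quot_pi_frac.
by split=> [/eqP|Pa]; [|apply/eqP]; rewrite prime_quot_pi_eq0 unfold_in => *;
  apply/asboolP.
Qed.

End ResidueField.

(** * Minimal covers and dimension over the residue field *)

Section LocalRing.
Variables (R : comNzRingType) (m : submodClosed R^o).
Implicit Types U V W : lmodType R.
Hypotheses (nR : noetherian R) (lR : local_ring m).

Definition row_in n (v : 'rV[R]_n) := forall i, v 0 i \in (m : {pred R^o}).

Definition killed V := forall (a : R) (x : V), a \in (m : {pred R^o}) ->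
  a *: x = 0.

(** The map [phi] identifies [V] with [R^n / m R^n], so [V] is a vector space of dimension [n] over
    the residue field, without any such structure being set up. *)
Definition has_basis V n := exists phi : {linear 'rV[R]_n -> V},
  onto phi /\ forall v, phi v = 0 <-> row_in v.

Lemma maximal_mulr (a b : R) : a \in (m : {pred R^o}) ->
  b * a \in (m : {pred R^o}).
Proof. exact: (@rpredZ _ _ (m : submodClosed R^o) b). Qed.

Lemma residue_field_map : exists (F : fieldType) (pi : {rmorphism R -> F}),
  forall a, pi a = 0 <-> a \in (m : {pred R^o}).
Proof.
have [] := @prime_field R (fun a => a \in (m : {pred R^o})).
- by move=> a b am bm; apply: (@rpredD _ (m : submodClosed R^o)).
- by move=> a b; apply: maximal_mulr.
- exact: (@rpred0 _ (m : submodClosed R^o)).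
- by apply/negP; case: lR => -[].
- by move=> a b; apply: maximal_ideal_prime.
by move=> F [pi [pi0 _]]; exists F, pi.
Qed.

(** Each of [phi] and [psi] lifts through the other. Modulo [m] the composite of the lifts is the
    identity of [F^n], and it factors through [F^p]. *)
Lemma has_basis_leq V n p : has_basis V n -> has_basis V p -> (n <= p)%N.
Proof.
move=> [phi [phis phi0]] [psi [psis psi0]].
have [al alE] := row_projective phi psis; have [be beE] :=
  row_projective psi phis.
have [F [pi pi0]] := residue_field_map.
pose A := map_mx pi (lin1_mx al); pose B := map_mx pi (lin1_mx be).
apply: (@mulmx1_min _ _ _ A B); rewrite -map_mxM.
apply/matrixP => i j; apply/esym/eqP; rewrite -subr_eq0 !mxE /=.
pose e : 'rV[R]_n := delta_mx 0 i; have em : row_in (e - be (al e)).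
  by apply/phi0; rewrite linearB beE alE subrr.
have /pi0 := em j; rewrite mxE [X in _ + X]mxE lin1_mxE
  (lin1_mxE al) /e -mulmxA -rowE !mxE.
rewrite rmorphB eqxx /= rmorph_nat.
by rewrite [j == i]eq_sym => ->.
Qed.

Lemma has_basis_unique V n p : has_basis V n -> has_basis V p -> n = p.
Proof. by move=> Vn Vp; apply/eqP; rewrite eqn_leq !(has_basis_leq (V := V)).
Qed.

Lemma has_basis_bij U V (f : {linear U -> V}) n :
  bijective f -> has_basis U n -> has_basis V n.
Proof.
move=> /inverse_linear[g [fK gK]] [phi [phis phi0]]; exists (f \o phi); split.
  by move=> y; have [v vE] := phis (g y); exists v; rewrite /= vE gK.
move=> v; rewrite -phi0 /=; split=> [fv|->]; last by rewrite linear0.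
by rewrite -(fK (phi v)) fv linear0.
Qed.

Lemma resfield_basis n : has_basis {ffun 'I_n -> resfield m} n.
Proof.
have [|phi phiE] := @linear_exists R 'rV_n {ffun 'I_n -> resfield m}
    (fun v => [ffun i => quotpi m (v 0 i : R^o)]).
  by move=> a x y; apply/ffunP => i; rewrite !ffunE !mxE -linearP.
exists phi; split=> [h|v].
  exists (\row_i repr (h i)); rewrite phiE; apply/ffunP => i.
  by rewrite ffunE mxE quotpiK.
rewrite phiE; split=> [/ffunP v0 i|v0].
  by apply/quotpi_eq0P; have := v0 i; rewrite !ffunE.
by apply/ffunP => i; rewrite !ffunE; apply/quotpi_eq0P.
Qed.

Lemma has_basisP V n : has_basis V n <-> iso V {ffun 'I_n -> resfield m}.
Proof.
split=> [|[f /inverse_linear[g [fK gK]]]]; last first.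
  by apply: (@has_basis_bij _ _ g); [exists f | apply: resfield_basis].
move=> [phi [phis phi0]]; have [psi [psis psi0]] := resfield_basis n.
have [|f fE] := @factor_onto _ _ _ _ phi psi phis; first by move=> v /phi0/psi0.
exists f; apply: linear_bij => [x|y].
  by have [v <-] := phis x; rewrite fE => /psi0/phi0.
by have [v <-] := psis y; exists (phi v).
Qed.

Lemma dimkE V n : has_basis V n -> dimk m V = n.
Proof.
move=> Vn; apply: (@has_basis_unique V) => //; apply/has_basisP.
by rewrite /dimk; case: xgetP => // /(_ n) []; apply/has_basisP.
Qed.

(** A basis of [V] consists of the images of one of [U] and lifts of one of [W]. Since [m] kills
    [V], the lift [chi] vanishes on rows with entries in [m]. *)
Lemma has_basis_extension U V W (f : {linear U -> V}) (g : {linear V ->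
  W}) n p :
  killed V -> injective f -> (forall y, g y = 0 <-> exists x, f x = y) ->
  onto g -> has_basis U n -> has_basis W p -> has_basis V (n + p).
Proof.
move=> kV fi fg gs [phi [phis phi0]] [psi [psis psi0]].
have [chi chiE] := row_projective psi gs.
have [|h hE] := @linear_exists R 'rV_(n + p) V
    (fun v => f (phi (lsubmx v)) + chi (rsubmx v)).
  by move=> a x y; rewrite !linearP /= scalerDr addrACA.
have chi0 v : row_in v -> chi v = 0.
  by move=> vm; rewrite row_mapE big1 // => i _; apply: kV.
have gh v : g (h v) = psi (rsubmx v).
  by rewrite hE linearD chiE (fg _).2 ?add0r //; eexists.
exists h; split=> [y|v].
  have [b bE] := psis (g y); have [|x xE] := (fg (y - chi b)).1.
    by rewrite linearB chiE bE subrr.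
  have [a aE] := phis x; exists (row_mx a b).
  by rewrite hE row_mxKl row_mxKr aE xE subrK.
split=> [hv|vm].
  have rm : row_in (rsubmx v) by apply/psi0; rewrite -gh hv linear0.
  have lm : row_in (lsubmx v).
    by apply/phi0/fi; rewrite linear0 -hv hE chi0 ?addr0.
  move=> i; rewrite -[v]hsubmxK -(splitK i).
  by case: (fintype.split i) => j; rewrite ?row_mxEl ?row_mxEr.
rewrite hE chi0 ?addr0; last by move=> i; rewrite mxE.
by rewrite (phi0 _).2 ?linear0 // => i; rewrite mxE.
Qed.

(** Take the least possible number of generators: a relation with a coefficient outside [m], hence
    invertible, would allow one generator to be dropped. *)
Lemma minimal_cover V : fin_gen V ->
  exists n (phi : {linear 'rV[R]_n -> V}),
    onto phi /\ forall v, phi v = 0 -> row_in v.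
Proof.
move=> /fin_genP V_gen.
have ex_n : exists n, `[<exists phi : {linear 'rV[R]_n -> V}, onto phi>].
  by have [n phi] := V_gen; exists n; apply/asboolP.
case: (ex_minnP ex_n) => n /asboolP[phi phis] n_min; exists n, phi;
  split=> // v v0 i.
apply/idPn => /(notin_maximal_unit nR lR)[b bv].
case: n => [|n] in phi phis n_min v v0 i bv *; first by case: i bv.
suff /n_min : `[<exists psi : {linear 'rV[R]_n ->
  V}, onto psi>] by rewrite ltnn.
apply/asboolP; have [psi psiE] := row_map_ex (fun j => phi (delta_mx 0
  (fintype.lift i j))).
exists psi => x; have [a <-] := phis x.
(* Subtracting this multiple of the relation [v] clears coordinate [i] of [a] and leaves its image
   unchanged. *)
pose w := a - (a 0 i * b) *: v.
exists (\row_j w 0 (fintype.lift i j)).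
have -> : phi a = phi w by rewrite linearB linearZ /= v0 scaler0 subr0.
rewrite [RHS]row_mapE row_mapE (bigD1_ord i) //= !mxE -mulrA bv mulr1 subrr.
rewrite scale0r add0r; apply: eq_bigr => j _.
by rewrite psiE mxE.
Qed.

Lemma killed_has_basis V : fin_gen V -> killed V -> exists n, has_basis V n.
Proof.
move=> /minimal_cover[n [phi [phis phi0]]] kV; exists n, phi; split=> // v.
split=> [|vm]; first exact: phi0.
by rewrite row_mapE big1 // => i _; apply: kV.
Qed.

End LocalRing.

(** * Comparison of resolutions *)

Section Comparison.
Variable R : comNzRingType.
Implicit Types (U V W H : lmodType R) (A B : complex R).

(** Exactness of [Hom(H, A)] in terms of maps, the form in which it is used for comparison
    arguments. *)
Definition hom_lifting H A := forall n (h : {linear H -> A n}),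
  (forall x, h x \in (cycles A n : {pred A n})) ->
  exists h' : {linear H -> A n.+1}, forall x, cdiff A n (h' x) = h x.

Lemma exact_hom_complex H A : exact_complex
  (hom_complex H A) <-> hom_lifting H A.
Proof.
split=> [ex n h hc | lift n h hc]; last first.
  have [|h' h'E] := lift n (hom_fun h).
    move=> x; case: n h hc => // n h /ker_subP hc; apply/ker_subP.
    by have /(congr1 (fun f => hom_fun f x)) := hc.
  by apply/im_subP; exists (hom_of h'); apply: hom_eqP => x; apply: h'E.
have /im_subP[h' h'E] : hom_of h \in (boundaries
  (hom_complex H A) n : {pred _}).
  apply: ex; case: n h hc => // n h hc; apply/ker_subP/hom_eqP => x.
  by apply/ker_subP; apply: hc.
by exists (hom_fun h') => x; have := congr1 (fun f => hom_fun f x) h'E.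
Qed.

Lemma projective_hom_lifting H A : projective H -> exact_complex A ->
  hom_lifting H A.
Proof.
move=> pH exA n h hc; apply: projective_lift => // x.
by have /im_subP[y yE] := exA n _ (hc x); exists y.
Qed.

(** The invariant of the recursion is that [f n] composed with the differential of [A] takes values
    in cycles of [B]; the next map is then a lift. *)
Lemma comparison_map A B (f0 : {linear A 0 -> B 0}) :
  (forall n, hom_lifting (A n.+1) B) ->
  exists f : forall n, {linear A n -> B n}, f 0 = f0 /\
    forall n x, cdiff B n (f n.+1 x) = f n (cdiff A n x).
Proof.
move=> lift.
have [//|n f fc|f [fE0 _ fE]] := @dependent_choice (fun n => {linear A n ->
  B n})
  (fun n f => forall x, f (cdiff A n x) \in (cycles B n : {pred B n}))
  (fun n f f' => forall x, cdiff B n (f' x) = f (cdiff A n x)) f0.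
  have [f' f'E] := lift n n (f \o cdiff A n) fc; exists f' => // x.
  by apply/ker_subP; rewrite f'E /= cdiffK linear0.
by exists f; split.
Qed.

(** The invariant is that [f - g - s d] takes values in cycles; lifting it along the differential of
    [B] gives the next component of the homotopy. *)
Lemma comparison_homotopy A B (f g : forall n, {linear A n -> B n})
    (s0 : {linear A 0 -> B 1}) :
  (forall n x, cdiff B n (f n.+1 x) = f n (cdiff A n x)) ->
  (forall n x, cdiff B n (g n.+1 x) = g n (cdiff A n x)) ->
  (forall x, f 0 x - g 0 x = cdiff B 0 (s0 x)) ->
  (forall n, hom_lifting (A n.+1) B) ->
  exists s : forall n, {linear A n -> B n.+1}, s 0 = s0 /\
    forall n x, f n.+1 x - g n.+1 x = cdiff B n.+1 (s n.+1 x) + s n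
      (cdiff A n x).
Proof.
move=> fE gE fg0 lift.
have [|n s sc|s [sE0 _ sE]] := @dependent_choice (fun n => {linear A n ->
  B n.+1})
  (fun n s => forall x, cdiff B n (f n.+1 x - g n.+1 x - s (cdiff A n x)) = 0)
  (fun n s s' => forall x,
     f n.+1 x - g n.+1 x = cdiff B n.+1 (s' x) + s (cdiff A n x)) s0.
- by move=> x; rewrite !linearB /= fE gE -fg0 subrr.
- have [|h hE] := @linear_exists R (A n.+1) (B n.+1)
    (fun x => f n.+1 x - g n.+1 x - s (cdiff A n x)).
    move=> a x y; rewrite !linearP /= !scalerDr.
    by rewrite [X in X + _ = _]addrACA [LHS]addrACA.
  have [|s' s'E] := lift n n.+1 h; first by move=> x; apply/ker_subP;
    rewrite hE.
  exists s' => x; last by rewrite s'E hE subrK.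
  by rewrite !linearB /= fE gE s'E hE cdiffK linear0 subr0 subrr.
by exists s; split.
Qed.

Lemma subquot_iso U V (Z B : submodClosed U) (Z' B' : submodClosed V)
    (u : {linear U -> V}) (w : {linear V -> U}) :
  (forall x, x \in (Z : {pred U}) -> u x \in (Z' : {pred V})) ->
  (forall x, x \in (B : {pred U}) -> u x \in (B' : {pred V})) ->
  (forall y, y \in (Z' : {pred V}) -> w y \in (Z : {pred U})) ->
  (forall y, y \in (B' : {pred V}) -> w y \in (B : {pred U})) ->
  (forall x, x \in (Z : {pred U}) -> w (u x) - x \in (B : {pred U})) ->
  (forall y, y \in (Z' : {pred V}) -> u (w y) - y \in (B' : {pred V})) ->
  iso (subquot Z B) (subquot Z' B').
Proof.
move=> uZ uB wZ wB wu uw.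
have [|g gE] := @linear_exists R (submod Z) (submod Z')
    (fun z => SubMod (uZ _ (smvalP z))).
  by move=> a x y; apply: val_inj; rewrite /= linearP.
pose pZ : {linear submod Z -> subquot Z B} := quotpi _.
pose pZ' : {linear submod Z' -> subquot Z' B'} := quotpi _.
have [||f fE] := @factor_onto _ _ _ _ pZ (pZ' \o g); first exact: quotpi_onto.
  move=> z /quotpi_eq0P zB; apply/quotpi_eq0P.
  by rewrite mem_preim gE; apply: uB.
exists f; apply: linear_bij => [q|q].
  have [z <-] : exists z, pZ z = q by apply: quotpi_onto.
  rewrite fE => /quotpi_eq0P; rewrite mem_preim gE /= => uzB.
  apply/quotpi_eq0P; rewrite mem_preim /=.
  have -> : smval z = w (u (smval z)) - (w (u (smval z)) - smval z)
    by rewrite subKr.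
  by rewrite -scaleN1r rpredD ?wB // rpredZ // wu // smvalP.
have [z <-] : exists z, pZ' z = q by apply: quotpi_onto.
exists (pZ (SubMod (wZ _ (smvalP z)))); rewrite fE /=; apply/eqP;
  rewrite /pZ' quotpiE.
by rewrite mem_preim gE /=; apply: uw; apply: smvalP.
Qed.

(** Degree 0 has separate hypotheses, as no component of the homotopy arrives there from a lower
    degree. *)
Lemma homotopy_homology A B (f : forall n, {linear A n -> B n})
    (g : forall n, {linear B n -> A n}) (s : forall n, {linear A n -> A n.+1})
    (t : forall n, {linear B n -> B n.+1}) :
  (forall n x, cdiff B n (f n.+1 x) = f n (cdiff A n x)) ->
  (forall n x, cdiff A n (g n.+1 x) = g n (cdiff B n x)) ->
  (forall x, g 0 (f 0 x) - x = cdiff A 0 (s 0 x)) ->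
  (forall x, f 0 (g 0 x) - x = cdiff B 0 (t 0 x)) ->
  (forall n x, g n.+1 (f n.+1 x) - x = cdiff A n.+1 (s n.+1 x) + s n
    (cdiff A n x)) ->
  (forall n x, f n.+1 (g n.+1 x) - x = cdiff B n.+1 (t n.+1 x) + t n
    (cdiff B n x)) ->
  forall n, iso (homology A n) (homology B n).
Proof.
move=> fE gE gf0 fg0 gf fg n; apply: (subquot_iso (u := f n) (w := g n)).
- case: n => // n x /ker_subP xz; apply/ker_subP.
  by rewrite fE xz linear0.
- by move=> x /im_subP[y <-]; apply/im_subP; exists (f n.+1 y); rewrite fE.
- case: n => // n x /ker_subP xz; apply/ker_subP.
  by rewrite gE xz linear0.
- by move=> x /im_subP[y <-]; apply/im_subP; exists (g n.+1 y); rewrite gE.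
- case: n => [|n] x; first by rewrite gf0 => _; apply/im_subP; eexists.
  by move=> /ker_subP xz; rewrite gf xz linear0 addr0; apply/im_subP; eexists.
- case: n => [|n] x; first by rewrite fg0 => _; apply/im_subP; eexists.
  by move=> /ker_subP xz; rewrite fg xz linear0 addr0; apply/im_subP; eexists.
Qed.

End Comparison.

(** * Tensor products and their universal property *)

Section TensorProducts.
Variable R : comNzRingType.
Implicit Types (U V W N : lmodType R) (P Q : complex R).

Definition tens U N (x : U) (y : N) : tensor U N :=
  quotpi (span_sub (@bilin_rel R U N)) << (x, y) >>.

Lemma tens_eq U N (a b : {freeg (U * N)%type / R}) :
  bilin_rel (a - b) -> quotpi (span_sub (@bilin_rel R U N)) a = quotpi _ b.
Proof. by move=> ab; apply/eqP; rewrite quotpiE; apply: mem_span. Qed.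

Lemma tensDl U N (x x' : U) (y : N) : tens (x + x') y = tens x y + tens x' y.
Proof.
rewrite /tens -linearD; apply: tens_eq; rewrite opprD addrA; exact: bilin_addl.
Qed.
Lemma tensDr U N (x : U) (y y' : N) : tens x (y + y') = tens x y + tens x y'.
Proof.
rewrite /tens -linearD; apply: tens_eq; rewrite opprD addrA; exact: bilin_addr.
Qed.
Lemma tensZl U N a (x : U) (y : N) : tens (a *: x) y = a *: tens x y.
Proof. by rewrite /tens -linearZ; apply: tens_eq; apply: bilin_scalel. Qed.
Lemma tensZr U N a (x : U) (y : N) : tens x (a *: y) = a *: tens x y.
Proof. by rewrite /tens -linearZ; apply: tens_eq; apply: bilin_scaler. Qed.

Lemma tensor_ind U N (S : submodClosed (tensor U N)) :
  (forall x y, tens x y \in (S : {pred tensor U N})) ->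
  forall t, t \in (S : {pred tensor U N}).
Proof.
move=> Sxy t; rewrite -(quotpiK t) -(freeg_sumE
  (repr t)) linear_sum rpred_sum // => -[x y] _.
have -> c : << c *g (x, y) >> = c *: (<< (x, y) >> : {freeg (U * N)%type / R}).
  by apply/eqP/freeg_eqP => q; rewrite coeffZ !coeffU mul1r.
by rewrite linearZ rpredZ //; apply: Sxy.
Qed.

Lemma tensor_ext U N V (f g : {linear tensor U N -> V}) :
  (forall x y, f (tens x y) = g (tens x y)) -> f =1 g.
Proof.
move=> fg; have [|h hE] := @linear_exists R (tensor U N) V (fun t => f t - g t).
  by move=> a x y; rewrite !linearP /= scalerDr addrACA.
move=> t; apply/eqP; rewrite -subr_eq0 -hE; apply/eqP/ker_subP.
by apply: (@tensor_ind _ _ (ker_sub h)) => x y; apply/ker_subP;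
  rewrite hE fg subrr.
Qed.

Lemma tensor_map_tens U V N (f : {linear U -> V}) x (y : N) :
  tensor_map f (tens x y) = tens (f x) y.
Proof. by rewrite tensor_mapE free_mapE. Qed.

Lemma freeg_lift_linear (K : choiceType) V (f : K -> V) :
  exists g : {linear {freeg K / R} -> V}, forall k, g << k >> = f k.
Proof.
pose L : {freeg K / R} -> V := fglift f.
have LB : {morph L : x y / x - y} := lift_is_additive _.
have L0 : L 0 = 0 by rewrite -(subrr 0) LB subrr.
have LN x : L (- x) = - L x by rewrite -sub0r LB L0 sub0r.
have LD : {morph L : x y / x + y}.
  by move=> x y; rewrite -{1}[y]opprK LB LN opprK.
have lL : linear L.
  move=> a x y; rewrite LD; congr (_ + _); rewrite -(freeg_sumE x).
  elim: (dom x) => [|p s IH]; first by rewrite !big_nil scaler0 L0 scaler0.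
  rewrite !big_cons scalerDr !LD scalerDr IH; congr (_ + _).
  have -> : a *: << coeff p x *g p >> = << a * coeff p x *g p >> :> {freeg K
    / R}.
    by apply/eqP/freeg_eqP => q; rewrite coeffZ !coeffU mulrA.
  by rewrite /L !liftU scalerA.
have [g gE] := linear_exists lL; exists g => k.
by rewrite gE /L liftU scale1r.
Qed.

Lemma tensor_lift U N V (b : U -> N -> V) :
  (forall y, linear (b^~ y)) -> (forall x, linear (b x)) ->
  exists f : {linear tensor U N -> V}, forall x y, f (tens x y) = b x y.
Proof.
move=> bl br; have [g gE] := freeg_lift_linear (fun p : U * N => b p.1 p.2).
have bD y u v : b (u + v) y = b u y + b v y by have := bl y 1 u v;
  rewrite !scale1r.
have bD' x u v : b x (u + v) = b x u + b x v by have := br x 1 u v;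
  rewrite !scale1r.
have b0 y : b 0 y = 0 by apply: (addrI (b 0 y)); rewrite -bD !addr0.
have b0' x : b x 0 = 0 by apply: (addrI (b x 0)); rewrite -bD' !addr0.
have bZ y a u : b (a *: u) y = a *: b u y by have := bl y a u 0;
  rewrite !addr0 b0 addr0.
have bZ' x a u : b x (a *: u) = a *: b x u by have := br x a u 0;
  rewrite !addr0 b0' addr0.
pose p : {linear _ -> tensor U N} := quotpi (span_sub (@bilin_rel R U N)).
have [||f fE] := @factor_onto _ _ _ _ p g; first exact: quotpi_onto.
  move=> x /quotpi_eq0P/(@span_min _ _ _ (ker_sub g)) xg;
    apply/ker_subP/xg => {x xg} x xr.
  apply/ker_subP; case: xr => [u v n|u n q|a u n|a u n];
    rewrite !linearB ?linearZ /= !gE /=.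
  - by rewrite bD -addrA -opprD subrr.
  - by rewrite bD' -addrA -opprD subrr.
  - by rewrite bZ scalerN subrr.
  - by rewrite bZ' scalerN subrr.
by exists f => x y; rewrite /tens fE gE.
Qed.

End TensorProducts.

(** * Homology of tensor products *)

Section TensorHomology.
Variable R : comNzRingType.
Implicit Types (U V W N : lmodType R).

Lemma tens0l U N (y : N) : tens (0 : U) y = 0.
Proof. by rewrite -(scale0r (0 : U)) tensZl scale0r. Qed.

Lemma tensor_eq0 U N V (L : tensor U N -> V) :
  linear L -> (forall x y, L (tens x y) = 0) -> forall t, L t = 0.
Proof.
move=> /linear_exists[g gE] L0 t; rewrite -gE.
by apply: (@tensor_ext _ _ _ _ g \0) => x y; rewrite gE L0.
Qed.

Lemma tensor_map_null U V N (t : tensor U N) :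
  tensor_map (\0 : {linear U -> V}) t = 0.
Proof.
apply: (@tensor_ext _ _ _ _ (tensor_map \0) \0) => x y /=.
by rewrite tensor_map_tens tens0l.
Qed.

Lemma tensor_ext_sub U N V (f g h k : {linear tensor U N -> V}) :
  (forall x y, f (tens x y) - g (tens x y) = h (tens x y) + k (tens x y)) ->
  forall t, f t - g t = h t + k t.
Proof.
have [|p pE] := @linear_exists R (tensor U N) V (fun t => f t - g t).
  by move=> a x y; rewrite !linearP /= scalerDr addrACA.
have [|q qE] := @linear_exists R (tensor U N) V (fun t => h t + k t).
  by move=> a x y; rewrite !linearP /= scalerDr addrACA.
by move=> E t; rewrite -pE -qE; apply: tensor_ext => x y; rewrite pE qE.
Qed.

Lemma tensor_map_homotopy U V N (h : {linear U -> V}) (k : {linear V -> U})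
    W (d : {linear W -> U}) (s : {linear U -> W})
    (X : lmodType R) (d' : {linear U -> X}) (s' : {linear X -> U}) :
  (forall x, k (h x) - x = d (s x) + s' (d' x)) -> forall t : tensor U N,
  tensor_map k (tensor_map h t) - t =
  tensor_map d (tensor_map s t) + tensor_map s' (tensor_map d' t).
Proof.
move=> E; apply: (@tensor_ext_sub _ _ _ (tensor_map k \o tensor_map h) idfun
  (tensor_map d \o tensor_map s) (tensor_map s' \o tensor_map d')) => x y.
rewrite /= !tensor_map_tens -tensDl -E tensDl -[- x]scaleN1r tensZl.
by rewrite scaleN1r.
Qed.

(** Comparison of the augmented complexes over the identity of [V] yields a homotopy equivalence,
    which survives tensoring. Taking for [C] the projective or the totally reflexive modules covers
    Tor and relative Tor at once. *)
Lemma relative_tor_unique (C : lmodType R -> Prop) V (P Q : augcomplex V) :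
  (forall n, C (P n)) -> (forall n, C (Q n)) ->
  (forall H, C H -> hom_lifting H (augmented P)) ->
  (forall H, C H -> hom_lifting H (augmented Q)) ->
  forall N n, iso (homology (tensor_complex P N) n) (homology
    (tensor_complex Q N) n).
Proof.
move=> CP CQ liftP liftQ N n.
have [f [f0 fE]] := @comparison_map R (augmented P) (augmented Q) idfun
  (fun n => liftQ _ (CP n)).
have [g [g0 gE]] := @comparison_map R (augmented Q) (augmented P) idfun
  (fun n => liftP _ (CQ n)).
have [||x|n'|s [s0 sE]] := @comparison_homotopy R (augmented P) (augmented P)
  (fun n => g n \o f n) (fun n => idfun) \0.
- by move=> n' x; rewrite /= gE fE.
- by [].
- by rewrite /= f0 g0 /= subrr linear0.
- exact: liftP (CP n').
have [||x|n'|t [t0 tE]] := @comparison_homotopy R (augmented Q) (augmented Q)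
  (fun n => f n \o g n) (fun n => idfun) \0.
- by move=> n' x; rewrite /= fE gE.
- by [].
- by rewrite /= f0 g0 /= subrr linear0.
- exact: liftQ (CQ n').
(* The augmented complexes hold [V] in degree 0, whence the shift by one. *)
pose f' n : {linear P n -> Q n} := f n.+1.
pose g' n : {linear Q n -> P n} := g n.+1.
pose s' n : {linear P n -> P n.+1} := s n.+1.
pose t' n : {linear Q n -> Q n.+1} := t n.+1.
have chain U1 U2 V1 V2 (p : {linear U2 -> V2}) (d1 : {linear U1 -> U2})
    (q : {linear U1 -> V1}) (d2 : {linear V1 -> V2}) :
    (forall x, d2 (q x) = p (d1 x)) -> forall x : tensor U1 N,
    tensor_map d2 (tensor_map q x) = tensor_map p (tensor_map d1 x).
  move=> E; apply: (@tensor_ext _ _ _ _ (tensor_map d2 \o tensor_map q)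
    (tensor_map p \o tensor_map d1)) => x y /=.
  by rewrite !tensor_map_tens E.
apply: (@homotopy_homology R (tensor_complex P N) (tensor_complex Q N)
  (fun n => tensor_map (f' n)) (fun n => tensor_map (g' n))
  (fun n => tensor_map (s' n)) (fun n => tensor_map (t' n))) => {n}.
- by move=> n; apply: chain => x; apply: (fE n.+1).
- by move=> n; apply: chain => x; apply: (gE n.+1).
(* The term of the homotopy passing through [V] is zero because [s 0] is zero, so the second summand
   is taken with [d'] equal to [\0]. *)
- move=> x; rewrite (tensor_map_homotopy (d := cdiff P 0) (s := s' 0) (d' :=
  \0) (s' := idfun)).
    by rewrite [X in _ + X](_ : _ = 0) ?addr0 // tensor_map_null linear0.
  by move=> z; have /= := sE 0 z; rewrite s0.
- move=> x; rewrite (tensor_map_homotopy (d := cdiff Q 0) (s := t' 0) (d' :=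
  \0) (s' := idfun)).
    by rewrite [X in _ + X](_ : _ = 0) ?addr0 // tensor_map_null linear0.
  by move=> z; have /= := tE 0 z; rewrite t0.
- by move=> n; apply: tensor_map_homotopy => x; apply: (sE n.+1).
- by move=> n; apply: tensor_map_homotopy => x; apply: (tE n.+1).
Qed.

Lemma subquot_iso_onto V W (Z B : submodClosed V) (f : {linear submod Z -> W}) :
  onto f -> (forall z, f z = 0 <-> smval z \in (B : {pred V})) ->
  iso (subquot Z B) W.
Proof.
move=> fs f0; pose p : {linear submod Z -> subquot Z B} := quotpi _.
have p0 z : p z = 0 <-> smval z \in (B : {pred V}).
  by split=> [/quotpi_eq0P|zB]; last apply/quotpi_eq0P.
have [|z /p0/f0 //|g gE] := @factor_onto _ _ _ _ p f; first exact: quotpi_onto.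
exists g; apply: linear_bij => [q|w].
  have [z <-] : exists z, p z = q by apply: quotpi_onto.
  by rewrite gE => /f0/p0.
by have [z <-] := fs w; exists (p z).
Qed.

(** Right exactness. Modulo the image [I] of [tensor_map d], the class of a pure tensor of [x] and
    [y] depends only on [e x] and [y]; this bilinear map induces [L], and [L] composed with
    [tensor_map e] is the projection modulo [I]. *)
Lemma tensor_map_kernel U V W N (d : {linear U -> V}) (e : {linear V -> W}) :
  onto e -> (forall x, e x = 0 <-> exists y, d y = x) ->
  forall t : tensor V N, tensor_map e t = 0 <-> exists u, tensor_map d u = t.
Proof.
move=> es ed t; split=> [|[u <-]]; last first.
  apply: (@tensor_ext _ _ _ _ (tensor_map e \o tensor_map d) \0) => x y /=.
  by rewrite !tensor_map_tens (_ : e (d x) = 0) ?tens0l //; apply/ed; exists x.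
pose I := im_sub (@tensor_map _ _ _ N d).
have gex (y : N) : exists g : {linear W -> quotmod I}, forall x,
  g (e x) = quotpi I (tens x y).
  have [|h hE] := @linear_exists R V (quotmod I) (fun x => quotpi I (tens x y)).
    by move=> a u v; rewrite tensDl tensZl linearP.
  have [//|x|g gE] := @factor_onto _ _ _ _ e h; last by exists g => x;
    rewrite gE hE.
  move=> /ed[z <-]; rewrite hE; apply/quotpi_eq0P/im_subP.
  by exists (tens z y); apply: tensor_map_tens.
pose g y := projT1 (cid (gex y)).
have gE y x : g y (e x) = quotpi I (tens x y) by rewrite /g; case: cid.
have [y|w a y y'|L LE] := @tensor_lift R W N (quotmod I) (fun w y => g y w).
- by move=> a u v; rewrite linearP.
- by have [x <-] := es w; rewrite !gE tensDr tensZr linearP.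
have LpE : L \o tensor_map e =1 quotpi I.
  by apply: tensor_ext => x y /=; rewrite tensor_map_tens LE gE.
by move=> et; apply/im_subP/quotpi_eq0P; rewrite -LpE /= et linear0.
Qed.

Lemma tensor_map_onto U V N (f : {linear U -> V}) :
  onto f -> onto (@tensor_map _ _ _ N f).
Proof.
move=> fs t; apply/im_subP; apply: tensor_ind => y n; apply/im_subP.
by have [x <-] := fs y; exists (tens x n); apply: tensor_map_tens.
Qed.

Lemma tensor_homology0 V (P : augcomplex V) N : exact_complex (augmented P) ->
  iso (homology (tensor_complex P N) 0) (tensor V N).
Proof.
move=> exP.
have augs : onto (augm P).
  by move=> v; apply/im_subP; apply: (exP 0%N).
have aug0 x : augm P x = 0 <-> exists y, cdiff P 0 y = x.
  split=> [x0|[y <-]]; last exact: augmK.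
  by apply/im_subP; apply: (exP 1%N); apply/ker_subP.
pose Z := full_sub (tensor (P 0) N).
have [|f fE] := @linear_exists R (submod Z) (tensor V N)
    (fun z => tensor_map (augm P) (smval z)).
  by move=> a x y; rewrite /= linearP.
apply: (subquot_iso_onto (f := f)) => [t|z].
  by have [u <-] := tensor_map_onto augs t; exists (SubMod (isT : u \in Z));
    rewrite fE.
rewrite fE (tensor_map_kernel augs aug0).
by split=> [?|]; [apply/im_subP | move=> /im_subP].
Qed.

Lemma homology_zero_diff (A : complex R) n :
  (forall x, x \in (cycles A n : {pred A n})) -> (forall x, cdiff A n x = 0) ->
  iso (homology A n) (A n).
Proof.
move=> cA dA.
have [|f fE] := @linear_exists R (submod (cycles A n)) (A n) (@smval _ _ _).
  by move=> a x y.
apply: (subquot_iso_onto (f := f)) => [x|z]; first by exists (SubMod (cA x));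
  rewrite fE.
rewrite fE; split=> [->|/im_subP[y <-]]; first exact: rpred0.
exact: dA.
Qed.

End TensorHomology.

(** * Tensor products with the residue field *)

Section TensorResidue.
Variables (R : comNzRingType) (m : submodClosed R^o).
Implicit Types (U V W : lmodType R).
Local Notation k := (resfield m).
Hypotheses (nR : noetherian R) (lR : local_ring m).

Lemma resfield_gen (y : k) : exists c : R, y = c *: quotpi m (1 : R^o).
Proof.
exists (repr y : R); rewrite -[LHS]quotpiK -linearZ; congr (quotpi m _).
by rewrite /GRing.scale /= mulr1.
Qed.

Lemma tensor_residue_killed V : killed m (tensor V k).
Proof.
move=> a t am; apply: (@tensor_eq0 _ _ _ _ (fun t => a *: t)) => [b x y|x y].
  by rewrite scalerDr !scalerA mulrC.
rewrite -tensZr; have [c ->] := resfield_gen y.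
have -> : a *: (c *: quotpi m (1 : R^o)) = 0 *: (0 : k).
  rewrite scaler0 scalerA -linearZ; apply/quotpi_eq0P.
  by rewrite /GRing.scale /= mulr1 mulrC; apply: maximal_mulr.
by rewrite tensZr scale0r.
Qed.

Lemma tensor_residue_map V : exists f : {linear V -> tensor V k},
  onto f /\ forall x, f x = tens x (quotpi m (1 : R^o)).
Proof.
have [|f fE] := @linear_exists R V (tensor V k) (fun x => tens x (quotpi m
  (1 : R^o))).
  by move=> a x y; rewrite tensDl tensZl.
exists f; split=> // t; apply/im_subP; apply: tensor_ind => x y; apply/im_subP.
by have [c ->] := resfield_gen y; exists (c *: x); rewrite fE tensZl tensZr.
Qed.

Lemma tensor_residue_fin_gen V : fin_gen V -> fin_gen (tensor V k).
Proof. by have [f [fs _]] := tensor_residue_map V; apply: fin_gen_onto. Qed.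

Lemma tens_row_in n (v : 'rV[R]_n) (y : k) : row_in m v -> tens v y = 0.
Proof.
move=> vm; have [|f fE] := @linear_exists R 'rV[R]_n (tensor 'rV[R]_n k)
  (fun x => tens x y).
  by move=> a u w; rewrite tensDl tensZl.
rewrite -fE row_mapE big1 // => i _; exact: tensor_residue_killed.
Qed.

(** To see that the kernel is no larger than [m R^n], the bilinear map multiplying [y] by coordinate
    [i] of [x] is applied: it detects each coordinate modulo [m]. *)
Lemma tensor_row_basis n : has_basis m (tensor 'rV[R]_n k) n.
Proof.
have [f [fs fE]] := tensor_residue_map 'rV[R]_n; exists f; split=> // v.
split=> [fv i|vm]; last by rewrite fE tens_row_in.
have [y|x|g gE] := @tensor_lift R 'rV[R]_n k k (fun x y => x 0 i *: y).
- by move=> a u w; rewrite !mxE scalerDl scalerA.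
- by move=> a u w; rewrite scalerDr !scalerA mulrC.
have /quotpi_eq0P : quotpi m (v 0 i : R^o) = 0; last by [].
have := gE v (quotpi m (1 : R^o)); rewrite -fE fv linear0 -linearZ.
by rewrite /GRing.scale /= mulr1.
Qed.

Lemma tensor_minimal_map V p (d : {linear V -> 'rV[R]_p}) :
  (forall v, row_in m (d v)) -> forall t : tensor V k, tensor_map d t = 0.
Proof.
move=> dm; apply: (@tensor_ext _ _ _ _ (tensor_map d) \0) => v y /=.
by rewrite tensor_map_tens tens_row_in.
Qed.

End TensorResidue.

(** * Minimal free resolutions *)

Section MinimalResolutions.
Variables (R : comNzRingType) (m : submodClosed R^o).
Implicit Types (U V W : lmodType R).
Local Notation k := (resfield m).

Record minres V := Minres {
  mrank : nat -> nat;
  mdiff : forall i, {linear 'rV[R]_(mrank i.+1) -> 'rV[R]_(mrank i)};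
  maug : {linear 'rV[R]_(mrank 0) -> V};
  maug_onto : onto maug;
  maug_ker : forall x, maug x = 0 <-> exists y, mdiff 0 y = x;
  mdiff_ker : forall i x, mdiff i x = 0 <-> exists y, mdiff i.+1 y = x;
  mdiff_min : forall i x, row_in m (mdiff i x);
  maug_min : forall x, maug x = 0 -> row_in m x }.

Section MinresComplex.
Variables (V : lmodType R) (F : minres V).

Fact minres_diffK i x : mdiff F i (mdiff F i.+1 x) = 0.
Proof. by apply/mdiff_ker; exists x. Qed.
Definition minres_complex := Complex minres_diffK.
Fact minres_augK x : maug F (cdiff minres_complex 0 x) = 0.
Proof. by apply/maug_ker; exists x. Qed.
Definition minres_aug : augcomplex V := AugComplex minres_augK.

Lemma minres_exact : exact_complex (augmented minres_aug).
Proof.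
move=> [|[|n]] x xc; apply/im_subP.
- exact: (maug_onto F).
- by apply/maug_ker/ker_subP.
- by apply/mdiff_ker/ker_subP.
Qed.

Lemma minres_projective_resolution : projective_resolution minres_aug.
Proof. by split=> [|n]; [apply: minres_exact | apply: row_projective]. Qed.
End MinresComplex.

Hypotheses (nR : noetherian R) (lR : local_ring m).

(** Minimal covers are iterated on successive kernels, which are finitely generated because [R] is
    noetherian. *)
Lemma minres_exists V : fin_gen V -> inhabited (minres V).
Proof.
move=> /(minimal_cover nR lR)[n0 [e [es e_min]]].
(* A state is a rank together with the submodule of syzygies still to be covered; packing both makes
   the recursion an ordinary fixpoint. *)
pose ST := {n : nat & submodClosed 'rV[R]_n}.
pose spec (s : ST) p (d : {linear 'rV[R]_p -> 'rV[R]_(projT1 s)}) :=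
  (forall x, x \in (projT2 s : {pred _}) <-> exists y, d y = x) /\
  (forall v, d v = 0 -> row_in m v).
have pick (s : ST) : {p : nat & {d : {linear 'rV[R]_p ->
  'rV[R]_(projT1 s)} | spec s p d}}.
  suff /cid[p /cid[d ds]] : exists p d, spec s p d by exists p, d.
  case: s => n S.
  have /fin_gen_submod/(minimal_cover nR lR)[p [phi [phis phi_min]]] :=
    noetherian_row nR S.
  have [|d dE] := @linear_exists R 'rV[R]_p 'rV[R]_n (fun v => smval (phi v)).
    by move=> a x y; rewrite linearP.
  exists p, d; split=> [x|v]; last by rewrite dE => v0; apply: phi_min;
    apply: val_inj.
  split=> [Sx|[y <-]]; last by rewrite dE smvalP.
  by have [y yE] := phis (SubMod Sx); exists y; rewrite dE yE.
pose st := fix st i : ST := match i with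
  | 0 => existT _ n0 (ker_sub e)
  | i.+1 => existT _ (projT1 (pick (st i))) (ker_sub (sval (projT2 (pick
    (st i))))) end.
pose d i : {linear 'rV[R]_(projT1 (st i.+1)) -> 'rV[R]_(projT1 (st i))} :=
  sval (projT2 (pick (st i))).
have dS i x : x \in (projT2 (st i) : {pred _}) <-> exists y, d i y = x.
  by case: (svalP (projT2 (pick (st i)))).
have dmin i v : d i v = 0 -> row_in m v.
  by case: (svalP (projT2 (pick (st i)))) => _; apply.
have eker x : e x = 0 <-> exists y, d 0 y = x.
  by rewrite -(dS 0); split=> /ker_subP.
have dker i x : d i x = 0 <-> exists y, d i.+1 y = x.
  by rewrite -(dS i.+1); split=> /ker_subP.
have drow i x : row_in m (d i x).
  case: i x => [|i] x; first by apply: e_min; apply/eker; exists x.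
  by apply: (dmin i); apply/dker; exists x.
exact: inhabits (@Minres V (fun i => projT1
  (st i)) d e es eker dker drow e_min).
Qed.

Lemma choose_augP V (A : augcomplex V -> Prop) : (exists P, A P) ->
  A (choose_aug A).
Proof. by rewrite /choose_aug; case: pselect => // ex _; case: cid. Qed.

Lemma projresP V : fin_gen V -> projective_resolution (projres V).
Proof.
move=> /minres_exists[F]; apply: choose_augP.
by exists (minres_aug F); apply: minres_projective_resolution.
Qed.

Lemma minres_tensor_homology V (F : minres V) i :
  has_basis m (homology (tensor_complex (minres_aug F) k) i) (mrank F i).
Proof.
have [|x|f /inverse_linear[g [fK gK]]] := @homology_zero_diff _
  (tensor_complex (minres_aug F) k) i.
- case: i => [|i] x; first by [].
  by apply/ker_subP; apply: tensor_minimal_map; apply: mdiff_min.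
- by apply: tensor_minimal_map; apply: mdiff_min.
by apply: (@has_basis_bij _ _ _ _ g); [exists f | apply: tensor_row_basis].
Qed.

Lemma projective_tensor_homology V (F : minres V) (P : augcomplex V) i :
  projective_resolution P ->
  has_basis m (homology (tensor_complex P k) i) (mrank F i).
Proof.
move=> [exP pP]; have [exF pF] := minres_projective_resolution F.
have [f fb] := relative_tor_unique (C := @projective R) pF pP
  (fun H pH => projective_hom_lifting pH exF)
    (fun H pH => projective_hom_lifting pH exP) k i.
exact: has_basis_bij fb (minres_tensor_homology F i).
Qed.

Lemma betti_minres V (F : minres V) i : fin_gen V -> betti m i V = mrank F i.
Proof.
by move=> Vfg; apply: (dimkE nR lR); apply: projective_tensor_homology;
  apply: projresP.
Qed.

Lemma is_zero_has_basis V : is_zero V -> has_basis m V 0.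
Proof.
move=> V0; exists \0; split=> [y|v]; first by exists 0; rewrite [RHS]V0.
by split=> // _ [].
Qed.

(** The rank of [F] in degree [i] is the dimension of [Tor_i(V, k)], which can also be computed from
    the bounded resolution and is 0 beyond its length. *)
Lemma finite_pdim_minres V (F : minres V) : finite_pdim V ->
  exists N, forall i, (N < i)%N -> mrank F i = 0%N.
Proof.
move=> [N [P [Pres P0]]]; exists N => i Ni.
apply: (has_basis_unique nR lR (projective_tensor_homology F i Pres)).
apply: is_zero_has_basis => q; rewrite -(quotpiK q).
suff T0 : is_zero (tensor (P i) k).
  have -> : repr q = 0 by apply: val_inj; apply: T0.
  by rewrite linear0.
move=> t; apply: (@tensor_eq0 _ _ _ _ id) => // x y.
by rewrite (P0 i Ni x) tens0l.
Qed.

End MinimalResolutions.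

(** * Totally reflexive modules *)

Section TotallyReflexive.
Variables (R : comNzRingType) (m : submodClosed R^o).
Implicit Types (U V W H N : lmodType R).
Hypotheses (nR : noetherian R) (lR : local_ring m).

Lemma ext_is_zeroP V N i : is_zero (Ext i.+1 V N) <->
  forall f : {linear projres V i.+1 -> N},
    (forall x, f (cdiff (projres V) i.+1 x) = 0) ->
    exists g : {linear projres V i -> N},
      forall x, g (cdiff (projres V) i x) = f x.
Proof.
split=> [E0 f f0 | lift q].
  have fc : hom_of f \in (cocycles (hom_cocomplex
    (projres V) N) i.+1 : {pred _}).
    by apply/ker_subP/hom_eqP => x; apply: f0.
  have /quotpi_eq0P := E0 (quotpi _ (SubMod fc)).
  rewrite mem_preim /= => /im_subP[g gE]; exists (hom_fun g) => x.
  by have := congr1 (fun h => hom_fun h x) gE.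
rewrite -(quotpiK q); case: (repr q) => f fc; apply/quotpi_eq0P.
rewrite mem_preim /=; apply/im_subP.
have [x|g gE] := lift (hom_fun f); last by exists (hom_of g); apply: hom_eqP.
by have /ker_subP/(congr1 (fun h => hom_fun h x)) := fc.
Qed.

(** A section of the augmentation starts a contraction [s] of the augmented resolution. For a
    cocycle [f], the identity [x = d (s x) + s (d x)] gives [f x = f (s (d x))]. *)
Lemma ext_projective V N i : fin_gen V -> projective V ->
  is_zero (Ext i.+1 V N).
Proof.
move=> /(projresP nR lR)[exQ pQ] pV; apply/ext_is_zeroP => f f0.
have [x|s0 s0E] := projective_lift (f := augm (projres V)) (h := idfun) pV.
  by have /im_subP := exQ 0%N x isT.
have [|//|x|n|s [_ sE]] := @comparison_homotopy R (augmented (projres V))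
  (augmented (projres V))
  (fun n => idfun) (fun n => \0) s0.
- by [].
- by move=> n x; rewrite /= linear0.
- by rewrite /= s0E subr0.
- exact: projective_hom_lifting (pQ n) exQ.
exists (f \o s i.+1) => x; have /= := sE i.+1 x.
by rewrite subr0 => xE; rewrite [in RHS]xE linearD /= f0 add0r.
Qed.

Lemma row_dual_iso n : exists f : {linear 'rV[R]_n ->
  dual ('rV[R]_n : lmodType R)},
  bijective f /\ forall a x, hom_fun (f a) x = \sum_i a 0 i * x 0 i.
Proof.
pose form (a x : 'rV[R]_n) : R^o := \sum_i a 0 i * x 0 i.
have form_lin a : linear (form a).
  move=> b x y; rewrite /form /GRing.scale /= mulr_sumr -big_split /=.
  by apply: eq_bigr => i _; rewrite !mxE; ring.
have formC a x : form a x = form x a by apply: eq_bigr => i _; rewrite mulrC.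
have fP a : exists g : {linear 'rV[R]_n -> R^o},
  g =1 form a by apply: linear_exists.
pose F a := hom_of (projT1 (cid (fP a))).
have FE a x : hom_fun (F a) x = form a x by rewrite /hom_fun /F /=; case: cid.
have [|f fE] := @linear_exists R 'rV[R]_n (dual ('rV[R]_n : lmodType R)) F.
  move=> b x y; apply: hom_eqP => z; rewrite FE.
  by transitivity (b *: hom_fun (F x) z + hom_fun (F y) z) => //;
    rewrite !FE formC form_lin !(formC z).
exists f; split; last by move=> a x; rewrite fE FE.
have form_delta a i : form a (delta_mx 0 i) = a 0 i.
  rewrite /form (bigD1 i) //= mxE !eqxx mulr1 big1 ?addr0 // => j ji.
  by rewrite mxE (negbTE ji) mulr0.
apply: linear_bij => [a a0|g].
  apply/rowP => i; rewrite mxE -form_delta -FE -fE a0.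
  by [].
exists (\row_i hom_fun g (delta_mx 0 i)); apply: hom_eqP => x.
rewrite fE FE (row_mapE (hom_fun g)) /form; apply: eq_bigr => i _.
by rewrite mxE mulrC.
Qed.

Lemma biduality_linear V : linear (@biduality R V).
Proof. by move=> a x y; apply: hom_eqP => f;
  rewrite /hom_fun /= /dual_eval linearP. Qed.

Lemma row_totally_reflexive n : totally_reflexive ('rV[R]_n : lmodType R).
Proof.
have fg : fin_gen ('rV[R]_n : lmodType R).
  by apply/fin_genP; exists n, idfun => x; exists x.
have [f [fb fE]] := row_dual_iso n.
have fs : onto f by case: fb => g _ gK y; exists (g y).
split=> // [|[//|i] _|[//|i] _].
- have [b bE] := linear_exists (@biduality_linear 'rV[R]_n).
  suff bb : bijective b by apply: eq_bij bb _ bE.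
  have bfE x a : hom_fun (b x) (f a) = \sum_i a 0 i * x 0 i by rewrite bE -fE.
  have delta_sum x i : \sum_j (delta_mx 0 i : 'rV[R]_n) 0 j * x j = x i :> R.
    rewrite (bigD1 i) //= mxE !eqxx mul1r big1 ?addr0 // => j ji.
    by rewrite mxE (negbTE ji) mul0r.
  apply: linear_bij => [x x0|h].
    by apply/rowP => i; rewrite -(delta_sum (x 0)) -bfE x0 mxE.
  exists (\row_i hom_fun h (f (delta_mx 0 i))); apply: hom_eqP => g.
  have [a <-] := fs g; rewrite bfE [RHS](row_mapE (hom_fun h \o f)).
  by apply: eq_bigr => i _; rewrite mxE.
- by apply: ext_projective => //; apply: row_projective.
- apply: ext_projective; first exact: fin_gen_onto fs fg.
  exact: projective_iso fb (@row_projective R n).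
Qed.

(** The factorization of a cocycle is found one coordinate at a time. *)
Lemma ext_row_is_zero V n i : is_zero (Ext i.+1 V R^o) ->
  is_zero (Ext i.+1 V ('rV[R]_n : lmodType R)).
Proof.
move=> /ext_is_zeroP E; apply/ext_is_zeroP => f f0.
have gP j : exists g : {linear projres V i -> R^o},
    forall x, g (cdiff (projres V) i x) = f x 0 j.
  have [|h hE] := @linear_exists R (projres V i.+1) R^o (fun x => f x 0 j).
    by move=> a x y; rewrite linearP !mxE.
  have [x|g gE] := E h; first by rewrite hE f0 mxE.
  by exists g => x; rewrite gE hE.
pose g j := projT1 (cid (gP j)).
have gE j x : g j (cdiff (projres V) i x) = f x 0 j by rewrite /g; case: cid.
have [|h hE] := @linear_exists R (projres V i) 'rV[R]_n (fun x => \row_j g j x).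
  by move=> a x y; apply/rowP => j; rewrite !mxE linearP.
by exists h => x; rewrite hE; apply/rowP => j; rewrite mxE gE.
Qed.

(** Dimension shifting: the obstruction to lifting a map from [H] into the cycles of [A n] lies in
    Ext^1 of [H] into the cycles of [A n.+1], and boundedness makes all such Ext vanish. Ext is
    controlled from degree 2 on, since degrees 0 and 1 will hold [M] and [G]. *)
Lemma bounded_hom_lifting H (A : complex R) d : fin_gen H -> exact_complex A ->
  (forall n, (d < n)%N -> is_zero (A n)) ->
  (forall n i, is_zero (Ext i.+1 H (A n.+2))) -> hom_lifting H A.
Proof.
move=> Hfg exA A0 ExtA; have [exQ pQ] := projresP nR lR Hfg.
set Q := projres H in exQ pQ *.
(* By descending induction on n, cocycles of Hom(Q, -) with values in the cycles
   of A are coboundaries. *)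
have shift n i (c : {linear Q i.+1 -> A n.+1}) :
    (forall x, c x \in (cycles A n.+1 : {pred A n.+1})) ->
    (forall x, c (cdiff Q i.+1 x) = 0) ->
    exists b : {linear Q i -> A n.+1},
      (forall x, b x \in (cycles A n.+1 : {pred A n.+1})) /\
      forall x, b (cdiff Q i x) = c x.
  have [j dj] := ubnP (d.+1 - n)%N; elim: j => // j IHj in n dj i c *.
  move=> cc cd.
  have [dn|nd] := ltnP d n.+1.
    exists \0; split=> [x|x]; first by rewrite rpred0.
    by rewrite [LHS](A0 n.+1 dn) [RHS](A0 n.+1 dn).
  (* The lift [c'] need not be a cocycle; its defect [h] takes values in cycles one degree higher,
     where induction writes it as the coboundary of [b]. Then [c' - b] is a cocycle, hence a
     coboundary by the Ext hypothesis. *)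
  have [c' c'E] := projective_hom_lifting (pQ i.+1) exA cc.
  have [|h hE] := @linear_exists R (Q i.+2) (A n.+2) (c' \o cdiff Q i.+1).
    by move=> a x y; rewrite linearP.
  have [||x|b [bc bE]] := IHj n.+1 _ i.+1 h.
  - by move: dj; rewrite subSn ?(ltnW nd) // ltnS subSS.
  - by move=> x; apply/ker_subP; rewrite hE /= c'E cd.
  - by rewrite hE /= cdiffK linear0.
  have [|e eE] := @linear_exists R (Q i.+1) (A n.+2) (fun x => c' x - b x).
    by move=> a x y; rewrite !linearP /= scalerDr addrACA.
  have /ext_is_zeroP/(_ e)[x|g gE] := ExtA n i.
    by rewrite eE bE hE subrr.
  exists (cdiff A n.+1 \o g); split=> x /=; first by apply/ker_subP;
    rewrite cdiffK.
  by rewrite gE eE linearB /= c'E (ker_subP _ _ (bc x)) subr0.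
move=> n h hc.
have augs : onto (augm Q) by move=> v; apply/im_subP; apply: (exQ 0%N).
(* A lift exists on the free cover of [H], up to the defect [k]. Correcting it by [b] makes it
   vanish on relations, so it descends to [H]. *)
have [x|h' h'E] := projective_hom_lifting (pQ 0%N) exA (n := n) (h :=
  h \o augm Q).
  exact: hc.
have [|k kE] := @linear_exists R (Q 1%N) (A n.+1) (h' \o cdiff Q 0).
  by move=> a x y; rewrite linearP.
have [x|x|b [bc bE]] := shift n 0%N k.
- by apply/ker_subP; rewrite kE /= h'E /= augmK linear0.
- by rewrite kE /= cdiffK linear0.
have [|e eE] := @linear_exists R (Q 0%N) (A n.+1) (fun x => h' x - b x).
  by move=> a x y; rewrite !linearP /= scalerDr addrACA.
have [x x0|g gE] := @factor_onto _ _ _ _ (augm Q) e augs.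
  have /im_subP[y <-] : x \in (boundaries (augmented Q) 1 : {pred _}).
    by apply: (exQ 1%N); apply/ker_subP.
  by rewrite eE [aug_diff _ _ y]/= bE kE subrr.
exists g => x; have [y <-] := augs x.
by rewrite gE eE linearB h'E /= (ker_subP _ _ (bc y)) subr0.
Qed.

End TotallyReflexive.

(** * The proper G-resolution obtained from a G-approximation *)

Section Splice.
Variables (R : comNzRingType) (m : submodClosed R^o).
Implicit Types (U V W H N : lmodType R).
Hypotheses (nR : noetherian R) (lR : local_ring m).
Local Notation k := (resfield m).
Variables (M K G : lmodType R) (f : {linear K -> G}) (g : {linear G -> M}).
Hypothesis fgG : G_approximation f g.
Variable F : minres m K.

Let f_inj : injective f. Proof. by case: fgG => _ []. Qed.
Let g_ker y : g y = 0 <-> exists x, f x = y. Proof. by case: fgG => _ []. Qed.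
Let g_onto : onto g. Proof. by case: fgG => _ []. Qed.

Fact splice_augK x : (f \o maug F) (cdiff (minres_complex F) 0 x) = 0.
Proof. rewrite /= (_ : maug F _ = 0) ?linear0 //; apply/maug_ker;
  by exists x. Qed.
(** Regarding [F] as augmented to [G] through [f] puts [G] in degree 0 and the degree [n] term of
    [F] in degree [n.+1]. *)
Definition splice_complex := augmented (AugComplex splice_augK).
Fact splice_gK x : g (cdiff splice_complex 0 x) = 0.
Proof. by apply/g_ker; exists (maug F x). Qed.
Definition splice : augcomplex M := AugComplex splice_gK.

Lemma splice_ker y : g y = 0 <-> exists x, (f \o maug F) x = y.
Proof.
rewrite g_ker; split=> [[z <-]|[x <-]]; last by exists (maug F x).
by have [x <-] := maug_onto F z; exists x.
Qed.

Lemma splice_exact : exact_complex (augmented splice).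
Proof.
move=> [|[|[|n]]] x xc; apply/im_subP.
- exact: g_onto.
- by apply/splice_ker/ker_subP.
- apply/maug_ker/f_inj; rewrite linear0; exact/ker_subP.
- by apply/mdiff_ker/ker_subP.
Qed.

Lemma splice_G_resolution : G_resolution splice.
Proof.
split=> [|[|n]]; [exact: splice_exact | by case: fgG |].
exact: row_totally_reflexive nR lR _.
Qed.

Lemma splice_hom_lifting H : totally_reflexive H ->
  hom_lifting H (augmented splice).
Proof.
move=> [Hfg _ Hext _]; have [_ _ _ Kpd] := fgG.
have [d dF] := finite_pdim_minres nR lR F Kpd.
(* The degree [n] term of [F] sits in degree [n.+2] of the augmented splice, hence the bound
   [d.+2]. *)
apply: (@bounded_hom_lifting R m nR lR H _ d.+2 Hfg splice_exact) => [[|[|n]]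
  // dn x|n i].
  by move: x; rewrite /= dF // => x; apply: thinmx0.
by apply: ext_row_is_zero; apply: Hext.
Qed.

(** The splice shows that a proper G-resolution exists, so [properGres M] is one and not the
    default; the two agree by uniqueness relative to totally reflexive modules. *)
Lemma splice_TorG n : iso (homology (tensor_complex splice k) n) (TorG n M k).
Proof.
have spG : G_resolution splice /\ proper_resolution splice.
  split; first exact: splice_G_resolution.
  by move=> H HG; apply/exact_hom_complex/splice_hom_lifting.
have [[_ pG] pP] : G_resolution (properGres M) /\ proper_resolution
  (properGres M).
  by apply: (@choose_augP R M (fun P => G_resolution P /\ proper_resolution
    P)); exists splice.
apply: (@relative_tor_unique R (@totally_reflexive R)) => //.
- by case: splice_G_resolution.
- exact: splice_hom_lifting.
- by move=> H HG; apply/exact_hom_complex/pP.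
Qed.

Lemma betti_tensor V : fin_gen V -> has_basis m (tensor V k) (betti m 0 V).
Proof.
move=> Vfg; have [E] := minres_exists nR lR Vfg.
have [h hb] := tensor_homology0 k (@minres_exact _ _ _ E).
by rewrite (betti_minres nR lR E) //; apply: has_basis_bij hb
  (minres_tensor_homology E 0).
Qed.

Lemma bettiG_splice n b :
  has_basis m (homology (tensor_complex splice k) n) b -> bettiG m n M = b.
Proof.
by move=> hb; have [h hbij] := splice_TorG n; apply: (dimkE nR lR);
  apply: has_basis_bij hbij hb.
Qed.

Lemma bettiG0 : bettiG m 0 M = betti m 0 M.
Proof.
have [[_ _ Mfg] _ _ _] := fgG.
apply: bettiG_splice; have [h /inverse_linear[h' [hK h'K]]] :=
  tensor_homology0 k splice_exact.
by apply: (@has_basis_bij _ _ _ _ h'); [exists h | apply: betti_tensor].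
Qed.

(** From degree 2 on, the differentials entering and leaving a term of the splice are those of [F],
    and minimality kills them after tensoring with [k]. *)
Lemma bettiGSS n : bettiG m n.+2 M = mrank F n.+1.
Proof.
apply: bettiG_splice.
have [x|x|h /inverse_linear[h' [hK h'K]]] :=
  @homology_zero_diff _ (tensor_complex splice k) n.+2.
- by apply/ker_subP; apply: tensor_minimal_map; apply: mdiff_min.
- by apply: tensor_minimal_map; apply: mdiff_min.
by apply: (@has_basis_bij _ _ _ _ h'); [exists h | apply: tensor_row_basis].
Qed.

(** Count dimensions along [t]: its kernel is the relative Tor in degree 1 and, by right exactness,
    its cokernel is [M] tensored with [k]. Eliminating the dimension [r] of the image gives the
    formula, kept additive to stay in [nat]. *)
Lemma bettiG1 : (bettiG m 1 M + betti m 0 G = mrank F 0 + betti m 0 M)%N.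
Proof.
have [[Kfg Gfg Mfg] _ _ _] := fgG.
pose t : {linear tensor 'rV[R]_(mrank F 0) k -> tensor G k} :=
  tensor_map (f \o maug F).
have kG : killed m (tensor G k) := @tensor_residue_killed R m G.
have kF : killed m (tensor 'rV[R]_(mrank F 0) k) :=
  @tensor_residue_killed R m _.
have kS V (S : submodClosed V) : killed m V -> killed m (submod S).
  by move=> kV a x am; apply: val_inj; apply: kV.
have fgS V (S : submodClosed V) : fin_gen V -> fin_gen (submod S).
  by move=> Vfg; apply/fin_gen_submod/(noetherian_fin_gen nR Vfg).
have Ffg : fin_gen ('rV[R]_(mrank F 0) : lmodType R).
  by apply/fin_genP; exists (mrank F 0), idfun => x; exists x.
have [r rb] := killed_has_basis nR lR (fgS _ (im_sub t)
  (tensor_residue_fin_gen m Gfg)) (kS _ _ kG).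
have [h hb] := killed_has_basis nR lR (fgS _ (ker_sub t)
  (tensor_residue_fin_gen m Ffg)) (kS _ _ kF).
have inc V (S : submodClosed V) : exists i : {linear submod S ->
  V}, i =1 @smval _ _ S.
  by apply: linear_exists => a x y.
have [tc tcE] : exists tc : {linear _ -> submod (im_sub t)}, forall x,
  smval (tc x) = t x.
  by apply: corestriction => x; apply/im_subP; exists x.
have tcs : onto tc.
  by case=> y ty; have /im_subP[x xE] := ty; exists x; apply: val_inj;
    rewrite /= tcE.
have eF : (h + r)%N = mrank F 0.
  apply: (has_basis_unique nR lR _ (tensor_row_basis m (mrank F 0))).
  have [i iE] := inc _ (ker_sub t).
  apply: (has_basis_extension (f := i) (g := tc)) => //.
    by move=> x y; rewrite !iE; apply: val_inj.
  move=> y; split=> [y0|[x <-]].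
    have yK : y \in (ker_sub t : {pred _}) by apply/ker_subP; rewrite -tcE y0.
    by exists (SubMod yK); rewrite iE.
  by apply: val_inj; rewrite /= tcE iE; apply/ker_subP; apply: smvalP.
have eG : (r + betti m 0 M)%N = betti m 0 G.
  apply: (has_basis_unique nR lR _ (betti_tensor Gfg)).
  have [i iE] := inc _ (im_sub t).
  apply: (has_basis_extension (f := i) (g := @tensor_map _ _ _ k g)) => //.
  - by move=> x y; rewrite !iE; apply: val_inj.
  - move=> y; rewrite (tensor_map_kernel g_onto splice_ker);
    split=> [[u uE]|[x <-]].
      have yI : y \in (im_sub t : {pred _}) by apply/im_subP; exists u.
      by exists (SubMod yI); rewrite iE.
    by rewrite iE; case: x => x /= /im_subP.
  - exact: tensor_map_onto g_onto.
  - exact: betti_tensor.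
(* The differential arriving in degree 1 becomes zero, so the homology there is the whole kernel of
   [t]. *)
have -> : bettiG m 1 M = h.
  apply: bettiG_splice.
  have [//||q /inverse_linear[q' [qK q'K]]] :=
    @subquot_iso_onto _ _ (submod (ker_sub t))
    (cycles (tensor_complex splice k) 1) (boundaries
      (tensor_complex splice k) 1) idfun.
  - by move=> z; exists z.
  - move=> z; split=> [z0|/im_subP[y yE]].
      by rewrite (_ : z = 0) ?rpred0.
    by apply: val_inj; rewrite /= -yE; apply: tensor_minimal_map;
      apply: mdiff_min.
  by apply: (@has_basis_bij _ _ _ _ q'); [exists q | exact: hb].
by rewrite -eF -eG; ring.
Qed.

End Splice.

(** * Generic ranks and Euler characteristics *)

Section GenericRank.
Variables (R : comNzRingType) (x : R) (L : fieldType) (pi : {rmorphism R -> L}).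
Hypothesis pi0 : forall a, pi a = 0 <-> x * a = 0.
Hypothesis pi_frac : forall z, exists a b, pi b != 0 /\ z = pi a / pi b.

Lemma clear_denominators p q (A : 'M[L]_(p, q)) : exists (B : 'M[R]_(p, q)) b,
  pi b != 0 /\ pi b *: A = map_mx pi B.
Proof.
have cd (s : seq ('I_p * 'I_q)) : exists2 b, pi b != 0 &
    forall ij, ij \in s -> exists c, pi b * A ij.1 ij.2 = pi c.
  elim: s => [|ij s [b b0 bE]]; first by exists 1; rewrite ?rmorph1 ?oner_neq0.
  have [c [d [d0 Aij]]] := pi_frac (A ij.1 ij.2).
  exists (b * d) => [|kl]; first by rewrite rmorphM mulf_neq0.
  rewrite inE => /orP[/eqP->|/bE[u uE]].
    by exists (b * c); rewrite !rmorphM Aij -mulrA [_ / _]mulrC mulVKf.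
  by exists (d * u); rewrite !rmorphM mulrAC uE mulrC.
have [b b0 bE] := cd (enum {: 'I_p * 'I_q}).
have cP i j : exists c, pi b * A i j = pi c by apply: (bE (i, j));
  rewrite mem_enum.
exists (\matrix_(i, j) projT1 (cid (cP i j))), b; split=> //.
by apply/matrixP => i j; rewrite !mxE; case: cid.
Qed.

(* As x kills exactly the kernel of pi, an R-linear relation modulo ker pi
   becomes a genuine relation after multiplication by x *)
Lemma row_free_reduction p q (A : 'M[R]_(p, q)) s : pi s != 0 ->
  (forall c : 'rV_p, c *m A = 0 -> s *: c = 0) -> row_free (map_mx pi A).
Proof.
move=> s0 sA; rewrite -kermx_eq0; apply/eqP/row_matrixP => i; rewrite row0.
set v := row i _; have vA : v *m map_mx pi A = 0.
  by rewrite /v -row_mul mulmx_ker row0.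
have [w [b [b0 wE]]] := clear_denominators v.
have xwA : x *: w *m A = 0.
  rewrite -scalemxAl; apply/rowP => j; rewrite mxE [RHS]mxE; apply/pi0.
  have : map_mx pi (w *m A) 0 j = 0 by rewrite map_mxM -wE -scalemxAl vA
    scaler0 mxE.
  by rewrite mxE.
apply/rowP => j; rewrite [RHS]mxE; apply: (mulfI b0); apply: (mulfI s0);
  rewrite !mulr0.
have -> : pi b * v 0 j = pi (w 0 j) by have /rowP/(_ j) := wE; rewrite !mxE.
rewrite -rmorphM; apply/pi0.
by have /rowP/(_ j) := sA _ xwA; rewrite !mxE mulrCA.
Qed.

Lemma row_free_leq p q (A : 'M[R]_(p, q)) s : pi s != 0 ->
  (forall c : 'rV_p, c *m A = 0 -> s *: c = 0) -> (p <= q)%N.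
Proof. by move=> s0 /(row_free_reduction s0)/eqP <-; apply: rank_leq_col. Qed.

(** Over [L] the rows of [A] extend to a basis; clearing denominators in the added rows gives [B].
    The adjugate [S] and the determinant [D] express invertibility up to [D] already over [R]. *)
Lemma row_free_complete p q (A : 'M[R]_(p, q)) : row_free (map_mx pi A) ->
  exists r (B : 'M[R]_(r, q)) (S : 'M[R]_(q, p + r)) D,
    [/\ (p + r = q)%N, pi D != 0, col_mx A B *m S = D%:M
      & S *m col_mx A B = D%:M].
Proof.
move=> Afree; pose C := row_base (map_mx pi A)^C%MS.
have pq : (p + \rank (map_mx pi A)^C%MS = q)%N.
  rewrite mxrank_compl -{1}(eqP Afree) subnKC //; exact: rank_leq_col.
have ACfull : row_full (col_mx (map_mx pi A) C).
  rewrite -sub1mx -addsmxE; apply: submx_trans (addsmxS (submx_refl _) _).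
    by rewrite sub1mx; apply: addsmx_compl_full.
  by rewrite eq_row_base.
move: C ACfull pq; set r := \rank _ => C ACfull pq.
(* Replacing [q] by [p + r] makes the stacked matrix square, so that its determinant is defined. *)
exists r; clearbody r; move: A Afree C ACfull; case: q / pq => A Afree C ACfull.
have [B [b [b0 CE]]] := clear_denominators C.
have Tu : map_mx pi (col_mx A B) \in unitmx.
  rewrite -row_full_unit -sub1mx; apply: submx_trans (_ : (col_mx
    (map_mx pi A) C <= _)%MS).
    by rewrite sub1mx.
  rewrite map_col_mx col_mx_sub -!addsmxE addsmxSl /=.
  apply: submx_trans (addsmxSr _ _).
  by rewrite -CE eqmx_scale.
exists B, (\adj (col_mx A B)), (\det (col_mx A B)); split=> //.
- by move: Tu; rewrite unitmxE det_map_mx unitfE.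
- exact: mul_mx_adj.
- exact: mul_adj_mx.
Qed.

End GenericRank.

(** * Tails of the Euler characteristic as generic ranks *)

Section EulerCharacteristic.
Variables (R : comNzRingType) (m : submodClosed R^o).
Variables (x : R) (L : fieldType) (pi : {rmorphism R -> L}).
Hypothesis pi0 : forall a, pi a = 0 <-> x * a = 0.
Hypothesis pi_frac : forall z, exists a b, pi b != 0 /\ z = pi a / pi b.
Variables (V : lmodType R) (F : minres m V).

(* Up to a denominator s outside ker pi, the rows of B are a basis of a free
   complement of the image of F_(i+1) in F_i *)
Definition generic_complement i a := exists (B : 'M[R]_(a, mrank F i)) s,
  [/\ pi s != 0,
      forall c : 'rV[R]_a, aug_diff (minres_aug F) i (c *m B) = 0 -> s *: c = 0
    & forall v : 'rV[R]_(mrank F i), exists (c : 'rV[R]_a) w,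
        s *: v = c *m B + mdiff F i w].

Lemma aug_diff_ker i (y : 'rV[R]_(mrank F i)) :
  aug_diff (minres_aug F) i y = 0 <-> exists w, mdiff F i w = y.
Proof. by case: i y => [|i] y; [apply: maug_ker | apply: mdiff_ker]. Qed.

(** The rows of [A], images of the complement [B'], are generically a basis of the image of the
    differential. Completing them to a generic basis of the degree [i] term gives its complement, of
    rank [mrank F i - a]. *)
Lemma generic_complement_step i a : generic_complement i.+1 a ->
  exists2 b, (a + b = mrank F i)%N & generic_complement i b.
Proof.
move=> [B' [s' [s'0 ker' gen']]].
have dB' c : mdiff F i (c *m B') = c *m (B' *m lin1_mx (mdiff F i)).
  by rewrite lin1_mxE mulmxA.
pose A := B' *m lin1_mx (mdiff F i).
have /(row_free_complete pi_frac) : row_free (map_mx pi A).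
  apply: (row_free_reduction pi0 pi_frac s'0) => c cA; apply: ker'.
  by rewrite /= dB'.
move=> [b [B [S [D [ab D0 TS ST]]]]]; exists b => //.
exists B, (D * s'); split=> [|c /aug_diff_ker[w wE]|v].
- by rewrite rmorphM mulf_neq0.
(* A combination of [B] in the kernel is a boundary, so [s'] times it is also a combination of [A];
   multiplying by [S] separates the two blocks up to [D]. *)
- have [c' [w' wE']] := gen' w.
  have cB : s' *: c *m B = c' *m A.
    rewrite -scalemxAl -wE -linearZ wE' linearD /= dB'.
    by rewrite (_ : mdiff F i _ = 0) ?addr0 //; apply/mdiff_ker; exists w'.
  have : row_mx (- c') (s' *: c) *m col_mx A B *m S = 0.
    by rewrite mul_row_col mulNmx cB addNr mul0mx.
  rewrite -mulmxA TS mul_mx_scalar scale_row_mx -[RHS]row_mx0 => /eq_row_mx[_].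
  by rewrite scalerA.
(* The two halves of [v *m S] are the coordinates of [D *: v] along [A] and [B]. *)
- exists (s' *: rsubmx (v *m S)), (s' *: (lsubmx (v *m S) *m B')).
  rewrite linearZ /= dB' -scalemxAl -scalerDr addrC -mul_row_col hsubmxK.
  by rewrite -mulmxA ST mul_mx_scalar scalerA mulrC.
Qed.

Definition euler_tail N i : int :=
  \sum_(i <= n < N) (-1) ^+ (n - i) * (mrank F n)%:Z.

Lemma euler_tail_recl N i : (i < N)%N ->
  euler_tail N i = (mrank F i)%:Z - euler_tail N i.+1.
Proof.
move=> iN; rewrite /euler_tail big_ltn // subnn expr0 mul1r; congr (_ + _).
rewrite -sumrN; apply: eq_big_nat => n /andP[ni _].
by rewrite -(subnSK ni) exprS mulN1r mulNr.
Qed.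

(** Descending induction from [N], where the module is zero and the empty family is a complement.
    Since [a] is a natural number, every tail is nonnegative. *)
Lemma generic_complement_exists N i : (forall n, (N <= n)%N ->
  mrank F n = 0%N) ->
  exists a, generic_complement i a /\ a%:Z = euler_tail N i.
Proof.
move=> FN; have [j] := ubnP (N - i)%N; elim: j => // j IHj in i *.
move=> Nij; have [Ni|iN] := leqP N i.
  exists 0%N; rewrite /euler_tail big_geq //; split=> //.
  exists 0, 1; split=> [|c _|v]; first by rewrite rmorph1 oner_neq0.
    by rewrite [c]thinmx0 scaler0.
  exists 0, 0; rewrite linear0 mulmx0 addr0 scale1r; apply/rowP => l.
  by have := ltn_ord l; rewrite {2}FN.
have [|a [/generic_complement_step[b ab ib] aE]] := IHj i.+1.
  by rewrite -ltnS; apply: leq_ltn_trans Nij; rewrite subnSK.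
by exists b; split=> //; rewrite euler_tail_recl // -aE -ab PoszD addrC addKr.
Qed.

(** In [W], the images under [f] of [a] generically independent elements and lifts of [r]
    independent elements of [U] are jointly generically independent. They remain so when lifted to
    the free cover [R^e], so there are at most [e] of them. *)
Lemma generic_rank_leq (W U : lmodType R) a r e (f : {linear V ->
  W}) (g : {linear W -> U})
    (mu : {linear 'rV[R]_r -> U}) (phi : {linear 'rV[R]_e -> W}) :
  generic_complement 0 a -> injective f -> (forall y, g (f y) = 0) -> onto g ->
  (forall v, mu v = 0 -> v = 0) -> onto phi -> (a + r <= e)%N.
Proof.
move=> [B [s [s0 sB _]]] f_inj gf gs mu0 phis.
have [h hE] := row_projective mu gs.
have [|t tE] := @linear_exists R 'rV[R]_(a + r) W
    (fun v => f (maug F (lsubmx v *m B)) + h (rsubmx v)).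
  by move=> b v w; rewrite linearP /= mulmxDl -scalemxAl !linearP /= scalerDr
    addrACA.
have [al alE] := row_projective t phis.
apply: (row_free_leq pi0 pi_frac s0 (A := lin1_mx al)) => c.
rewrite -lin1_mxE => alc.
have tc : t c = 0 by rewrite -alE alc linear0.
have rc : rsubmx c = 0.
  by apply: mu0; rewrite -hE -[LHS]add0r -(gf (maug F
    (lsubmx c *m B))) -linearD -tE tc linear0.
have lc : s *: lsubmx c = 0.
  by apply: sB; apply: f_inj; move: tc; rewrite tE rc !linear0 addr0.
by rewrite -[c]hsubmxK scale_row_mx rc scaler0 lc row_mx0.
Qed.

End EulerCharacteristic.

(** * Free submodules of modules of given rank *)

Section Rank.
Variable R : comNzRingType.

(** Write a basis of the localization as fractions and send the standard basis to the numerators.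
    Localized, [mu v] has as coordinates those of [v] times the denominators, which are
    nonzerodivisors. *)
Lemma has_rank_embedding (M : lmodType R) r : has_rank M r ->
  exists mu : {linear 'rV[R]_r -> M}, forall v, mu v = 0 -> v = 0.
Proof.
move=> [f /(@inverse_linear (total_frac R))[h [fK hK]]].
have ex j : exists p : M * denom R, h (delta_mx 0 j) = Defs.frac p.1 p.2.
  by case: (fracW (h (delta_mx 0 j))) => y u; exists (y, u).
pose p j := projT1 (cid (ex j)).
have pE j : h (delta_mx 0 j) = Defs.frac (p j).1 (p j).2 by rewrite /p;
  case: cid.
have [mu muE] := row_basis_map (fun j => (p j).1); exists mu => v mv0.
pose io (y : M) : loc M := Defs.frac y (den1 R).
have ioD y z : io (y + z) = io y + io z.
  rewrite fracD; apply: frac_eq => /=. by rewrite !mul1r !scale1r.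
have ioZ (a : R) (u : denom R) y : io (a *: y) = (Defs.frac (a * u : R^o)
  (den1 R) : total_frac R) *: Defs.frac y u.
  rewrite [RHS]loc_mulE; apply: frac_eq; rewrite /= scale1r scalerA mul1r.
  by rewrite mulrC.
have io_sum (s : seq 'I_r) (y : 'I_r -> M) : io
  (\sum_(j <- s) y j) = \sum_(j <- s) io (y j).
  elim: s => [|j s IHs]; first by rewrite !big_nil.
  by rewrite !big_cons ioD IHs.
have fmu : f (io (mu v)) = \row_j (Defs.frac (v 0 j * (p j).2 : R^o)
  (den1 R) : total_frac R).
  rewrite muE io_sum linear_sum [RHS]row_sum_delta; apply: eq_bigr => j _.
  by rewrite (ioZ _ (p j).2) linearZ -pE hK mxE.
apply/rowP => j; rewrite mxE.
have : f (io (mu v)) 0 j = 0 by rewrite mv0 (_ : io 0 = 0) // linear0 mxE.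
rewrite fmu mxE => /fracP[w]; rewrite scaler0 mulr1 /GRing.scale /= => wvp.
have := denomP (p j).2; have := denomP w; rewrite !unfold_in => /asboolP w0
  /asboolP p0.
by apply: p0; rewrite mulrC; apply: w0.
Qed.

End Rank.

(** Bounded support turns the finitely supported sums defining [chi] and [chiG] into sums over an
    interval. *)
Lemma fsum_tail (F : nat -> int) i N : (forall n, (N <= n)%N -> F n = 0) ->
  \sum_(n \in [set n | (i <= n)%N]%classic) F n = \sum_(i <= n < N) F n.
Proof.
move=> F0; rewrite -(@bigfs _ _ _ _ (iota 0 N) (leq i)) ?iota_uniq //;
  last first.
  by move=> n _; rewrite mem_iota add0n /= -leqNgt => /F0.
by rewrite [RHS](@big_nat_widenl _ _ _ _ 0) // /index_iota subn0.
Qed.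

(** * Formulas and inequalities for the G-Euler characteristics *)

Theorem proposition2p6 (R : comNzRingType) (m : submodClosed R^o)
    (M K G : lmodType R) (f : {linear K -> G}) (g : {linear G -> M})
    (i : nat) :
  noetherian R -> local_ring m -> fin_gen M -> finite_Gdim M ->
  G_approximation f g ->
  [/\ (i != 1%N -> 0 <= chiG m i M),
      chiG m 1 M = (betti m 0 M)%:Z - (betti m 0 G)%:Z + chi m K
      /\ (betti m 0 M)%:Z - (betti m 0 G)%:Z <= chiG m 1 M
    & forall r : nat, has_rank M r -> r%:Z <= chiG m 0 M].
Proof.
move=> nR lR Mfg _ fgG.
have [[Kfg Gfg _] [f_inj g_ker g_onto] _ Kpd] := fgG.
have [F] := minres_exists nR lR Kfg; have [E] := minres_exists nR lR Gfg.
have [d dF] := finite_pdim_minres nR lR F Kpd.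
have [x x0 x_prime] := prime_annihilator nR.
(* [L] is the fraction field of [R] modulo the annihilator of [x], which is proper as [x] is
   nonzero. *)
have [|b c xc||/eqP||L [pi [pi0 pi_frac]]] :=
  @prime_field R (fun a => x * a = 0).
- by move=> b c xb xc; rewrite mulrDr xb xc addr0.
- by rewrite mulrCA xc mulr0.
- by rewrite mulr0.
- by rewrite mulr1; apply/negP.
- exact: x_prime.
have chiK : chi m K = euler_tail F d.+1 0.
  rewrite /chi /euler_tail (_ : [set: nat]%classic = [set n |
    (0 <= n)%N]%classic).
    rewrite (@fsum_tail _ _ d.+1) => [|n dn];
      last by rewrite (betti_minres nR lR F) // dF ?mulr0.
    by apply: eq_bigr => n _; rewrite subn0 (betti_minres nR lR F).
  by apply/seteqP.
(* Positivity of [j] matters: the relative Betti number in degree 1 may differ from the rank of [F]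
   in degree 0. The bound grows to [d.+2] by the index shift. *)
have chiGS j : (0 < j)%N -> chiG m j.+1 M = euler_tail F d.+1 j.
  move=> j0; rewrite /chiG (@fsum_tail _ _ d.+2) => [|[|n] //= dn]; last first.
    by case: n dn => // n dn; rewrite (bettiGSS nR lR fgG F) dF ?mulr0.
  rewrite big_add1 /=; apply: eq_big_nat => n /andP[jn _].
  by case: n jn => [|n] jn; [rewrite leqn0 in jn;
    rewrite (eqP jn) in j0 | rewrite (bettiGSS nR lR fgG F)].
have chiG_recl j : (j < d.+2)%N -> chiG m j M =
  (bettiG m j M)%:Z - chiG m j.+1 M.
  have van n : (d.+2 <= n)%N -> bettiG m n M = 0%N.
    by case: n => [|[|n]] // dn; rewrite (bettiGSS nR lR fgG F) dF.
  move=> jd; rewrite /chiG !(@fsum_tail _ _ d.+2) => [|n /van->|n /van->];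
    rewrite ?mulr0 //.
  rewrite big_ltn // subnn expr0 mul1r; congr (_ + _).
  rewrite -sumrN; apply: eq_big_nat => n /andP[jn _].
  by rewrite -(subnSK jn) exprS mulN1r mulNr.
have tail0 := euler_tail_recl F (ltn0Sn d).
have chiG2 := chiGS 1%N isT.
have b1 : (bettiG m 1 M)%:Z + (betti m 0 G)%:Z = (mrank F 0)%:Z +
  (betti m 0 M)%:Z.
  by rewrite -!PoszD (bettiG1 nR lR fgG F).
have chiG1 : chiG m 1 M = (betti m 0 M)%:Z - (betti m 0 G)%:Z + chi m K.
  rewrite chiG_recl // chiG2 chiK tail0.
  by apply: (addIr (betti m 0 G)%:Z); rewrite addrAC b1; ring.
have chiG0 : chiG m 0 M = (betti m 0 G)%:Z - chi m K.
  by rewrite chiG_recl // chiG1 (bettiG0 nR lR fgG F); ring.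
have tail_ge0 j : 0 <= euler_tail F d.+1 j.
  by have [a [_ <-]] := generic_complement_exists pi0 pi_frac j dF.
have rank_leq r (mu : {linear 'rV[R]_r -> M}) : (forall v, mu v = 0 ->
  v = 0) -> r%:Z <= chiG m 0 M.
  (* In degree 0 the generic complement has rank [chi m K], and the augmentation of [E] covers [G]
     by a free module of rank [betti m 0 G]. *)
  move=> mu0; have [a [ca aE]] := generic_complement_exists pi0 pi_frac 0 dF.
  rewrite chiG0 chiK -aE lerBrDl -PoszD lez_nat (betti_minres nR lR E) //.
  apply: (generic_rank_leq pi0 pi_frac ca f_inj _ g_onto mu0
    (maug_onto E)) => y.
  by apply/g_ker; exists y.
split=> [i1||r /has_rank_embedding[mu]].
(* For [i] at least 2 the characteristic is a tail for [F]; for [i = 0] nonnegativity is the rank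
   inequality for the zero map from [R^0]. *)
- case: i i1 => [|[|j]] // _; last by rewrite chiGS.
  by apply: (@rank_leq 0 \0) => v _; apply: thinmx0.
- by rewrite chiG1; split=> //; rewrite lerDl chiK.
- exact: rank_leq.
Qed.
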